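(* The space $T^*(T^* )$ is asymptotic-subsequential-$c_0$ but not asymptotic-$c_0$.
   Context: Tsirelson's space $T$ is the completion of $c_{00}$ under the unique norm satisfying $\|x\|_T=\max\{\|x\|_\infty,\frac12\sup\sum_{j=1}^n\|E_j(x)\|_T\}$, the supremum over all $n$ and finite sets $n\le E_1<E_2<\dots<E_n$ (i.e. $n\le\min E_1$ and $\max E_j<\min E_{j+1}$), where $E(x)=\sum_{j\in E}\lambda_je_j$ for $x=\sum\lambda_je_j$. $T^*$ is its dual, with the $1$-unconditional basis $(e_j)$ of coordinate functionals. For a Banach space $U$ with $1$-unconditional basis $(u_k)$, $U(X)$ is the space of sequences $(x_k)$ in $X$ with $\sum\|x_k\|u_k$ convergent in $U$, normed by $\|(x_k)\|=\|\sum\|x_k\|u_k\|_U$; $T^*(T^* )$ is this with $U=X=T^*$. Two finite basic sequences are $C$-equivalent if there are $A,B>0$ with $AB\le C$ and $\frac1A\|\sum a_ix_i\|\le\|\sum a_iy_i\|\le B\|\sum a_ix_i\|$. For a Banach space $X$ and $N$, $\{X\}_N$ is the set of norms $E$ on $\mathbb R^N$ with unit vector basis $(e_j)$ normalized monotone such that: for every $\varepsilon>0$, for every closed finite-codimensional $X_1$ there is $x_1\in S_{X_1}$, ..., for every closed finite-codimensional $X_N$ there is $x_N\in S_{X_N}$, with $(x_j)_{j=1}^N$ $(1+\varepsilon)$-equivalent to $(e_j)$. $X$ is asymptotic-$c_0$ if for some $c\ge1$ every $E\in\{X\}_k$, $k\in\mathbb N$, has basis $c$-equivalent to the unit vector basis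 of $\ell_\infty^k$. An infinite dimensional $X$ is asymptotic-subsequential-$c_0$ if there is $C\ge1$ such that for every $n$ there is $N$ such that for every $E\in\{X\}_N$ there are $i_1<\dots<i_n$ with $(e_{i_k})_{k=1}^n$ $C$-equivalent to the unit vector basis of $\ell_\infty^n$. *)

(* Defs.v *)
From mathcomp Require Import all_boot all_order all_algebra.
From mathcomp Require Import all_classical all_reals.
Set Implicit Arguments. Unset Strict Implicit. Unset Printing Implicit Defensive.
Import Order.TTheory GRing.Theory Num.Theory.
Local Open Scope classical_set_scope.
Local Open Scope ring_scope.

Section Defs.
Variable R : realType.

(* ---------------- scalar sequences (coordinates indexed 0,1,2,...;
   coordinate i stands for the basis vector e_{i+1} of the paper) ---------- *)

Definition c00_bound (x : nat -> R) (M : nat) : Prop :=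
  forall i, (M <= i)%N -> x i = 0.
Definition c00 (x : nat -> R) : Prop := exists M, c00_bound x M.

Definition sup_norm (x : nat -> R) : R := sup (range (fun i => `|x i|)).

Definition restr (E : seq nat) (x : nat -> R) : nat -> R :=
  fun k => if k \in E then x k else 0.

(* n <= E_1 < E_2 < ... < E_n  (1-based indexing of the paper, i.e. every
   element index a (0-based) satisfies n <= a+1) *)
Definition admissible (n : nat) (F : 'I_n -> seq nat) : Prop :=
  (forall i, uniq (F i)) /\
  (forall i a, a \in F i -> (n <= a.+1)%N) /\
  (forall (i j : 'I_n) a b, (i < j)%N -> a \in F i -> b \in F j -> (a < b)%N).

Definition admissible_sums (nT : (nat -> R) -> R) (x : nat -> R) : set R :=
  [set r | exists n (F : 'I_n -> seq nat),
     admissible F /\ r = \sum_(i < n) nT (restr (F i) x)].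

Definition is_tsirelson_norm (nT : (nat -> R) -> R) : Prop :=
  (forall x, c00 x -> 0 <= nT x) /\
  (forall x, c00 x -> nT x = 0 -> forall i, x i = 0) /\
  (forall x (k : R), c00 x -> nT (fun i => k * x i) = `|k| * nT x) /\
  (forall x y, c00 x -> c00 y -> nT (fun i => x i + y i) <= nT x + nT y) /\
  (forall x, c00 x ->
     nT x = Num.max (sup_norm x) (2^-1 * sup (admissible_sums nT x))).

(* the dual T-dual of T: functionals on T are sequences y bounded on the unit ball
   of (c00, nT) (which is dense in T) *)
Definition dual_pairings (nT : (nat -> R) -> R) (y : nat -> R) : set R :=
  [set r | exists (x : nat -> R) (M : nat),
     c00_bound x M /\ nT x <= 1 /\ r = \sum_(i < M) y i * x i].

Definition in_Tdual (nT : (nat -> R) -> R) (y : nat -> R) : Prop :=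
  has_ubound (dual_pairings nT y).

Definition dual_norm (nT : (nat -> R) -> R) (y : nat -> R) : R :=
  sup (dual_pairings nT y).

Definition V := nat -> nat -> R.

Definition trunc (n : nat) (a : nat -> R) : nat -> R :=
  fun i => if (i < n)%N then a i else 0.

Definition cvg0 (u : nat -> R) : Prop :=
  forall e : R, 0 < e -> exists N, forall n, (N <= n)%N -> `|u n| < e.

(* sum_k a_k u_k converges in U = T-dual: its partial sums converge in norm to some
   element z of T-dual *)
Definition series_cvg_Tdual (nT : (nat -> R) -> R) (a : nat -> R) : Prop :=
  exists z, in_Tdual nT z /\
    cvg0 (fun n => dual_norm nT (fun i => z i - trunc n a i)).

Definition TdTd (nT : (nat -> R) -> R) : set V :=
  [set x | (forall k, in_Tdual nT (x k)) /\
           series_cvg_Tdual nT (fun k => dual_norm nT (x k))].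

(* the norm || sum_k ||x_k|| u_k ||_{T-dual}; the sum is the coefficient
   sequence (||x_k||)_k *)
Definition TdTd_norm (nT : (nat -> R) -> R) (x : V) : R :=
  dual_norm nT (fun k => dual_norm nT (x k)).

Definition vadd (x y : V) : V := fun k i => x k i + y k i.
Definition vsub (x y : V) : V := fun k i => x k i - y k i.
Definition vscale (c : R) (x : V) : V := fun k i => c * x k i.
Definition vzero : V := fun _ _ => 0.
Definition lincomb (m : nat) (c : 'I_m -> R) (v : 'I_m -> V) : V :=
  fun k i => \sum_(j < m) c j * v j k i.

Definition linear_subspace (S Y : set V) : Prop :=
  Y `<=` S /\ Y vzero /\ (forall x y, Y x -> Y y -> Y (vadd x y)) /\
  (forall c x, Y x -> Y (vscale c x)).

Definition closed_in (nv : V -> R) (S Y : set V) : Prop :=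
  forall (y : nat -> V) z, (forall n, Y (y n)) -> S z ->
    cvg0 (fun n => nv (vsub (y n) z)) -> Y z.

Definition finite_codim (S Y : set V) : Prop :=
  exists m (v : 'I_m -> V), (forall j, S (v j)) /\
    forall x, S x -> exists y c, Y y /\ x = vadd y (lincomb c v).

Definition closed_fincodim (S : set V) (nv : V -> R) (Y : set V) : Prop :=
  linear_subspace S Y /\ closed_in nv S Y /\ finite_codim S Y.

Definition infinite_dim (S : set V) : Prop :=
  forall m, exists v : 'I_m -> V, (forall j, S (v j)) /\
    forall c, lincomb c v = vzero -> forall j, c j = 0.

(* f, g : norms of coefficient vectors of two n-term sequences;
   C-equivalence: 1/A f(a) <= g(a) <= B f(a) with A B <= C *)
Definition C_equiv (C : R) (n : nat) (f g : ('I_n -> R) -> R) : Prop :=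
  exists A B : R, 0 < A /\ 0 < B /\ A * B <= C /\
    forall a, f a / A <= g a /\ g a <= B * f a.

Definition seq_norm (nv : V -> R) (n : nat) (x : 'I_n -> V) :
  ('I_n -> R) -> R := fun a => nv (lincomb a x).

Definition linf_norm (n : nat) (a : 'I_n -> R) : R :=
  \big[Num.max/0]_(i < n) `|a i|.

Definition unitv (N : nat) (j : 'I_N) : 'I_N -> R :=
  fun i => if i == j then 1 else 0.

Definition truncN (N m : nat) (a : 'I_N -> R) : 'I_N -> R :=
  fun i => if (i < m)%N then a i else 0.

Definition basis_norm (N : nat) (E : ('I_N -> R) -> R) : Prop :=
  (forall a, 0 <= E a) /\
  (forall a, E a = 0 -> forall i, a i = 0) /\
  (forall a (k : R), E (fun i => k * a i) = `|k| * E a) /\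
  (forall a b, E (fun i => a i + b i) <= E a + E b) /\
  (forall j, E (unitv j) = 1) /\
  (forall a m n, (m <= n)%N -> E (truncN m a) <= E (truncN n a)).

Fixpoint asym_game (S : set V) (nv : V -> R) (k : nat)
    (P : seq V -> Prop) (acc : seq V) : Prop :=
  match k with
  | 0 => P acc
  | k'.+1 => forall Y, closed_fincodim S nv Y ->
      exists x, Y x /\ nv x = 1 /\ asym_game S nv k' P (rcons acc x)
  end.

Definition in_asym_struct (S : set V) (nv : V -> R) (N : nat)
    (E : ('I_N -> R) -> R) : Prop :=
  basis_norm E /\
  forall eps : R, 0 < eps ->
    asym_game S nv N
      (fun s => C_equiv (1 + eps) (seq_norm nv (fun i : 'I_N => nth vzero s i)) E)
      [::].

Definition asymptotic_c0 (S : set V) (nv : V -> R) : Prop :=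
  exists c : R, 1 <= c /\
    forall k (E : ('I_k -> R) -> R), in_asym_struct S nv E ->
      C_equiv c E (@linf_norm k).

Definition spread (n N : nat) (s : 'I_n -> 'I_N) (a : 'I_n -> R) : 'I_N -> R :=
  fun j => \sum_(k < n | s k == j) a k.

Definition asymptotic_subsequential_c0 (S : set V) (nv : V -> R) : Prop :=
  infinite_dim S /\
  exists C : R, 1 <= C /\
    forall n, exists N, forall E : ('I_N -> R) -> R, in_asym_struct S nv E ->
      exists s : 'I_n -> 'I_N, {mono s : i j / (i < j)%N} /\
        C_equiv C (fun a => E (spread s a)) (@linf_norm n).

End Defs.

(* Main.v *)
(* Write X for the space, u_k for the outer and e_i for the inner unit vectors.

   X is not asymptotic-c_0: every closed finite-codimensional subspace contains a
   normalized vector of the form u_j (x) w, so the norm of T-dual on its first N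
   coordinates belongs to the N-th asymptotic structure of X; were these norms
   uniformly equivalent to the sup norm, the constant sequence 1 would be in
   T-dual, whereas tails of elements of T-dual tend to 0 in norm (T contains no
   l_1; shown by iterated averaging as in James' distortion argument).

   X is asymptotic-subsequential-c_0: in the game, let the j-th subspace consist of
   the vectors vanishing on a square [0, K_j)^2 that carries the previous vectors
   up to a small error.  At a fixed outer coordinate the vectors then have disjoint
   supports, and all but one of these lie in [4n, oo).  Any n vectors of T-dual with
   supports in [4n, oo) have a pointwise maximum of norm at most 3 times the largest
   norm.  This is applied to the inner coordinates and, beyond 4n, to the outer
   profiles; below 4n the outer profiles of n suitable vectors nearly agree by the
   pigeonhole principle, if N is large.

   The bound for the maximum is dual to a lower l_1 estimate for disjoint vectors
   in T: a sum of norms of m disjointly supported parts of x is at most (up to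
   epsilon) a sum of norms of x on 4m consecutive intervals. *)
Require Import Defs.
From mathcomp Require Import all_boot all_order all_algebra.
From mathcomp Require Import all_classical all_reals.
From mathcomp Require Import ring lra zify.
Set Implicit Arguments. Unset Strict Implicit. Unset Printing Implicit Defensive.
Import Order.TTheory GRing.Theory Num.Theory.
Local Open Scope classical_set_scope.
Local Open Scope ring_scope.

(** * Finitely supported sequences and admissible families *)

Lemma le_sup_of (R : realType) (E : set R) (r : R) : has_ubound E -> E r -> r <= sup E.
Proof. by move=> hE; apply: ub_le_sup. Qed.

Section C00.
Variable R : realType.
Implicit Types (x y z : nat -> R) (M : nat).

Lemma c00_bound_le x y M :
  (forall k, `|y k| <= `|x k|) -> c00_bound x M -> c00_bound y M.
Proof.
move=> yx xM i Mi; apply/eqP; rewrite -normr_le0.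
by apply: le_trans (yx i) _; rewrite xM // normr0.
Qed.

Lemma c00_le x y : (forall k, `|y k| <= `|x k|) -> c00 x -> c00 y.
Proof. by move=> yx [M xM]; exists M; apply: c00_bound_le xM. Qed.

Lemma c00D x y : c00 x -> c00 y -> c00 (fun i => x i + y i).
Proof.
move=> [M xM] [M' yM]; exists (maxn M M') => i; rewrite geq_max => /andP[a b].
by rewrite xM // yM // addr0.
Qed.

Lemma c00Z x (c : R) : c00 x -> c00 (fun i => c * x i).
Proof. by move=> [M xM]; exists M => i Mi; rewrite xM // mulr0. Qed.

Lemma c00_0 : c00 (fun=> 0 : R).
Proof. by exists 0%N. Qed.

Lemma c00_sum n (F : 'I_n -> nat -> R) :
  (forall i, c00 (F i)) -> c00 (fun k => \sum_(i < n) F i k).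
Proof.
elim: n F => [|n IH] F FP.
  rewrite (_ : (fun k => _) = fun=> 0); first exact: c00_0.
  by apply/funext => k; rewrite big_ord0.
rewrite (_ : (fun k => _) = fun k => \sum_(i < n) F (widen_ord (leqnSn n) i) k + F ord_max k).
  by apply: c00D (FP _); apply: IH.
by apply/funext => k; rewrite big_ord_recr.
Qed.

Lemma restr_le E x k : `|restr E x k| <= `|x k|.
Proof. by rewrite /restr; case: ifP => // _; rewrite normr0. Qed.

Lemma restr_bound E x M : c00_bound x M -> c00_bound (restr E x) M.
Proof. exact: c00_bound_le (restr_le E x). Qed.

Lemma restr_c00 E x : c00 x -> c00 (restr E x).
Proof. exact: c00_le (restr_le E x). Qed.

Definition unit_seq (k : nat) : nat -> R := fun i => (i == k)%:R.

Lemma unit_seq_bound k : c00_bound (unit_seq k) k.+1.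
Proof. by move=> i ki; rewrite /unit_seq; case: eqP => // e; move: ki; rewrite e ltnn. Qed.

Lemma unit_seq_c00 k : c00 (unit_seq k). Proof. by exists k.+1; apply: unit_seq_bound. Qed.

Lemma adm_disj n (F : 'I_n -> seq nat) i j a :
  admissible F -> a \in F i -> a \in F j -> i = j.
Proof.
move=> [_ [_ H]] ai aj; apply: val_inj; case: (ltngtP i j) => // ij.
- by have := H _ _ _ _ ij ai aj; rewrite ltnn.
- by have := H _ _ _ _ ij aj ai; rewrite ltnn.
Qed.

Lemma sum_at_most_one n (P : pred 'I_n) (c : R) :
  0 <= c -> (forall i j, P i -> P j -> i = j) ->
  \sum_(i < n) (if P i then c else 0) <= c.
Proof.
move=> c0 uP; case: (pickP P) => [i Pi|P0]; last first.
  by rewrite big1 // => i _; rewrite P0.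
rewrite (bigD1 i) //= Pi big1 ?addr0 // => j ji.
by case: ifP => // Pj; rewrite (uP _ _ Pi Pj) eqxx in ji.
Qed.

(** The induction measure: the norm is given by an implicit equation, so facts about it are proved
    by induction on the size of the support. *)
Definition card_supp M x : nat := \sum_(k < M) nat_of_bool (x k != 0%R).

Lemma card_supp0 M x : c00_bound x M -> card_supp M x = 0%N -> x = fun=> 0.
Proof.
move=> xM /eqP; rewrite sum_nat_eq0 => /forallP H; apply/funext => k.
case: (ltnP k M) => [kM|]; last exact: xM.
by have := H (Ordinal kM); rewrite /= eqb0 negbK => /eqP.
Qed.

Lemma card_supp_le M x y : (forall k, x k = 0 -> y k = 0) -> (card_supp M y <= card_supp M x)%N.
Proof.
move=> xy; apply: leq_sum => i _.
by have := xy i; case: eqP; case: eqP => // a b /(_ a).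
Qed.

Lemma card_supp_lt M x y : (forall k, x k = 0 -> y k = 0) -> c00_bound x M ->
  (exists2 k, x k <> 0 & y k = 0) -> (card_supp M y < card_supp M x)%N.
Proof.
move=> xy xM [k xk yk].
have kM : (k < M)%N by rewrite ltnNge; apply/negP => /xM.
rewrite /card_supp (bigD1 (Ordinal kM)) //= [X in (_ < X)%N](bigD1 (Ordinal kM)) //=.
rewrite yk eqxx /= add0n; case: eqP => //= _; rewrite add1n ltnS.
by apply: leq_sum => i _; have := xy i; case: eqP; case: eqP => // a b /(_ a).
Qed.

Lemma adm_whole_or_proper n (F : 'I_n -> seq nat) y M :
  c00_bound y M ->
  (exists i, restr (F i) y = y) \/
  (forall i, (card_supp M (restr (F i) y) < card_supp M y)%N).
Proof.
move=> yM; case: (pselect (exists i, restr (F i) y = y)) => [|H]; [by left|right=> i].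
apply: card_supp_lt => //; first by move=> k; rewrite /restr; case: ifP.
apply: contrapT => H2; apply: H; exists i; apply/funext => k.
rewrite /restr; case: ifP => // kF; apply: contrapT => yk; apply: H2.
by exists k; [move=> e; apply: yk; rewrite e | rewrite /restr kF].
Qed.

End C00.

(** * Auxiliary tools: intervals, tails, pigeonhole *)

Lemma bernoulli (R : realType) (t : R) k : -1 <= t -> 1 + k%:R * t <= (1 + t) ^+ k.
Proof.
move=> t1; elim: k => [|k IH]; first by rewrite mul0r addr0 expr0.
rewrite exprS; have t0 : 0 <= 1 + t by lra.
apply: le_trans (ler_wpM2l t0 IH); rewrite -natr1.
have : 0 <= k%:R * t ^+ 2 by rewrite mulr_ge0 // sqr_ge0.
by rewrite expr2; lra.
Qed.

Definition slice {R : realType} (u v : nat) (x : nat -> R) : nat -> R :=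
  fun k => if (u <= k < v)%N then x k else 0.

(* s lists the right end points of consecutive intervals, the first of which starts at u. *)
Fixpoint slice_sum {R : realType} (nT : (nat -> R) -> R) (x : nat -> R) (u : nat) (s : seq nat) : R :=
  if s is v :: s' then nT (slice u v x) + slice_sum nT x v s' else 0.

Definition tail {R : realType} (n : nat) (x : nat -> R) : nat -> R :=
  fun k => if (n <= k)%N then x k else 0.

(* y is in T-dual with norm at most B; no supremum is involved. *)
Definition dual_le {R : realType} (nT : (nat -> R) -> R) (y : nat -> R) (B : R) : Prop :=
  forall x M, c00_bound x M -> \sum_(i < M) y i * x i <= B * nT x.

Lemma pigeonhole (D : finType) N n (c : 'I_N -> D) : (#|D| * n < N)%N ->
  exists d, (n <= #|[set j | c j == d]%SET|)%N.
Proof.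
move=> h; apply: contrapT => H.
have Hd d : (#|[set j | c j == d]%SET| <= n)%N.
  by rewrite leqNgt; apply/negP => /ltnW le; apply: H; exists d.
move: h; rewrite ltnNge => /negP; apply.
rewrite -[N in (N <= _)%N]card_ord -sum1_card (partition_big c xpredT) //=.
rewrite -sum_nat_const; apply: leq_sum => d _; apply: leq_trans (Hd d).
by rewrite -sum1dep_card.
Qed.

Lemma increasing_enum N n (F : {set 'I_N}) : (n <= #|F|)%N ->
  exists s : 'I_n -> 'I_N, {mono s : i j / (i < j)%N} /\ forall i, s i \in F.
Proof.
case: n => [|n] nF; first by exists (fun i : 'I_0 => False_rect _ (notF (ltn_ord i))); split=> [[]|[]].
have [x0 x0F] : exists x, x \in F by apply/card_gt0P; apply: leq_trans nF.
pose s (i : 'I_n.+1) := nth x0 (enum F) i.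
have szi (i : 'I_n.+1) : (i < size (enum F))%N by rewrite -cardE (leq_trans _ nF).
have srt : sorted (fun i j : 'I_N => (i < j)%N) (enum F).
  rewrite /enum_mem; apply: sorted_filter; first by move=> i j k; apply: ltn_trans.
  by have := iota_ltn_sorted 0 N; rewrite -val_enum_ord sorted_map enumT.
have hs (i j : 'I_n.+1) : (i < j)%N -> (s i < s j)%N.
  have tr : transitive (fun i j : 'I_N => (i < j)%N) by move=> a b c'; apply: ltn_trans.
  by move=> ij; apply: (sorted_ltn_nth tr x0 srt) => //; rewrite inE szi.
exists s; split=> [i j|i]; last by rewrite -mem_enum mem_nth.
case: (ltngtP i j) => [/hs //|/hs h|/val_inj ->]; last by rewrite ltnn.
by rewrite ltnNge ltnW.
Qed.

(** * Monotonicity of the norm *)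

Section Tsirelson.
Variables (R : realType) (nT : (nat -> R) -> R) (hT : is_tsirelson_norm nT).
Implicit Types (x y z : nat -> R) (M : nat).

Lemma N_ge0 x : c00 x -> 0 <= nT x. Proof. by have [+ _] := hT; apply. Qed.

Lemma NZ x (k : R) : c00 x -> nT (fun i => k * x i) = `|k| * nT x.
Proof. by have [_ [_ [+ _]]] := hT; apply. Qed.

Lemma N_tri x y : c00 x -> c00 y -> nT (fun i => x i + y i) <= nT x + nT y.
Proof. by have [_ [_ [_ [+ _]]]] := hT; apply. Qed.

Lemma N_eq x : c00 x ->
  nT x = Num.max (sup_norm x) (2^-1 * sup (admissible_sums nT x)).
Proof. by have [_ [_ [_ [_ +]]]] := hT; apply. Qed.

Lemma N0 : nT (fun=> 0) = 0.
Proof.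
by have := NZ 0 (@c00_0 R); rewrite normr0 !mul0r.
Qed.

Lemma N_sum n (F : 'I_n -> nat -> R) : (forall i, c00 (F i)) ->
  nT (fun k => \sum_(i < n) F i k) <= \sum_(i < n) nT (F i).
Proof.
elim: n F => [|n IH] F FP.
  rewrite big_ord0 (_ : (fun k => _) = fun=> 0) ?N0 //.
  by apply/funext => k; rewrite big_ord0.
rewrite (_ : (fun k => _) = fun k => \sum_(i < n) F (widen_ord (leqnSn n) i) k + F ord_max k).
  rewrite big_ord_recr /=; apply: le_trans (N_tri _ (FP _)) _; first exact: c00_sum.
  by rewrite lerD2r IH.
by apply/funext => k; rewrite big_ord_recr.
Qed.

(** Disjointness charges each coordinate at most once. This a priori bound makes the supremum in the
    norm equation a genuine one. *)
Lemma adm_sum_le n (F : 'I_n -> seq nat) x M : admissible F -> c00_bound x M ->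
  \sum_(i < n) nT (restr (F i) x) <= \sum_(k < M) `|x k| * nT (unit_seq R k).
Proof.
move=> aF xM.
have H i : nT (restr (F i) x) <=
    \sum_(k < M) (if (k : nat) \in F i then `|x k| * nT (unit_seq R k) else 0).
  rewrite (_ : restr (F i) x =
      fun l => \sum_(k < M) (restr (F i) x k) * unit_seq R k l).
    apply: le_trans (N_sum _) _; first by move=> k; apply/c00Z/unit_seq_c00.
    apply: ler_sum => k _; rewrite NZ; last exact: unit_seq_c00.
    by rewrite /restr; case: ifP; rewrite ?normr0 ?mul0r.
  apply/funext => l; case: (ltnP l M) => lM.
    rewrite (bigD1 (Ordinal lM)) //= /unit_seq eqxx mulr1 big1 ?addr0 // => k kl.
    case: eqP => [e|]; last by rewrite mulr0.
    by case/eqP: kl; apply: val_inj.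
  rewrite (@restr_bound _ (F i) _ _ xM) // big1 // => k _.
  rewrite /unit_seq; case: eqP => [e|]; last by rewrite mulr0.
  by have := ltn_ord k; rewrite -e ltnNge lM.
apply: le_trans (ler_sum _ (fun i _ => H i)) _.
rewrite exchange_big /=; apply: ler_sum => k _.
apply: sum_at_most_one => [|i j]; last exact: adm_disj.
by apply: mulr_ge0 => //; apply/N_ge0/unit_seq_c00.
Qed.

Lemma adm0 : admissible (fun _ : 'I_0 => [::]).
Proof. by split=> [[]|]. Qed.

Lemma has_ub_adm x : c00 x -> has_ubound (admissible_sums nT x).
Proof.
move=> [M xM]; exists (\sum_(k < M) `|x k| * nT (unit_seq R k)) => r [n [F [aF ->]]].
exact: adm_sum_le.
Qed.

Lemma N_ge_adm n (F : 'I_n -> seq nat) x : c00 x -> admissible F ->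
  \sum_(i < n) nT (restr (F i) x) <= 2 * nT x.
Proof.
move=> cx aF; have : 2^-1 * \sum_(i < n) nT (restr (F i) x) <= nT x; last lra.
rewrite (N_eq cx) le_max; apply/orP; right; apply: ler_wpM2l; first by rewrite invr_ge0.
by apply: le_sup_of; [exact: has_ub_adm | exists n, F].
Qed.

Lemma N_ge_coord x k : c00 x -> `|x k| <= nT x.
Proof.
move=> cx; rewrite (N_eq cx) le_max; apply/orP; left.
apply: le_sup_of; last by exists k.
case: cx => M xM; exists (\sum_(i < M) `|x i|) => _ [i _ <-].
case: (ltnP i M) => iM; last by rewrite xM // normr0 sumr_ge0.
by rewrite (bigD1 (Ordinal iM)) //= lerDl sumr_ge0.
Qed.

Lemma N_ub x B : c00 x -> (forall k, `|x k| <= B) ->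
  (forall n (F : 'I_n -> seq nat), admissible F ->
     \sum_(i < n) nT (restr (F i) x) <= 2 * B) -> nT x <= B.
Proof.
move=> cx xB FB; rewrite (N_eq cx) ge_max; apply/andP; split.
  by apply: ge_sup; [exists `|x 0%N|; exists 0%N | move=> _ [k _ <-]].
have : sup (admissible_sums nT x) <= 2 * B; last lra.
(* The empty family shows that the set of admissible sums is nonempty. *)
apply: ge_sup; first by exists (\sum_(i < 0) nT (restr [::] x)), 0%N, (fun=> [::]); split=> //; exact: adm0.
by move=> _ [n [F [aF ->]]]; apply: FB.
Qed.

Lemma adm_whole_sum n (F : 'I_n -> seq nat) x i : admissible F ->
  restr (F i) x = x -> \sum_(i < n) nT (restr (F i) x) = nT x.
Proof.
move=> aF e; rewrite (bigD1 i) //= e big1 ?addr0 // => j ji.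
rewrite (_ : restr _ x = fun=> 0) ?N0 //; apply/funext => k; rewrite /restr.
case: ifP => // kj; rewrite -e /restr; case: ifP => // ki.
by rewrite (adm_disj aF ki kj) eqxx in ji.
Qed.

(** A family with a member covering the support of x has sum [nT x], contributes only half of it to
    the norm, and so cannot push the norm above B. Only families that shrink every support remain to
    be checked, as induction on the support requires. *)
Lemma N_ub_proper x B M : c00_bound x M -> (forall k, `|x k| <= B) ->
  (forall n (F : 'I_n -> seq nat), admissible F ->
     (forall i, (card_supp M (restr (F i) x) < card_supp M x)%N) ->
     \sum_(i < n) nT (restr (F i) x) <= 2 * B) -> nT x <= B.
Proof.
move=> xM xB FB; have cx : c00 x by exists M.
have B0 : 0 <= B by apply: le_trans (xB 0%N).
case: (leP (nT x) B) => // lt.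
have : nT x <= Num.max B (nT x / 2).
  apply: N_ub => // [k|n F aF]; first by rewrite le_max xB.
  case: (adm_whole_or_proper F xM) => [[i e]|pr].
    by rewrite (adm_whole_sum aF e) maxEle; case: ifP => H; lra.
  by apply: le_trans (FB _ _ aF pr) _; apply: ler_wpM2l => //; rewrite le_max lexx.
by rewrite le_max => /orP[]; lra.
Qed.

(** By induction on the support of y: coordinates and admissible sums of y are dominated, term by
    term, by those of x. *)
Lemma N_mono x y : c00 x -> (forall k, `|y k| <= `|x k|) -> nT y <= nT x.
Proof.
move=> [M xM]; have [s] := ubnP (card_supp M y); elim: s => // s IH in x y xM *.
move=> ys yx; have yM := c00_bound_le yx xM; have cx : c00 x by exists M.
apply: (N_ub_proper yM) => [k|n F aF pr].
  by apply: le_trans (yx k) _; apply: N_ge_coord.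
apply: le_trans (N_ge_adm cx aF); apply: ler_sum => i _.
apply: IH; first exact: restr_bound.
  exact: leq_trans (pr i) ys.
by move=> k; rewrite /restr; case: ifP.
Qed.

Lemma N_abs x y : c00 x -> (forall k, `|y k| = `|x k|) -> nT y = nT x.
Proof.
move=> cx e; have cy : c00 y by apply: c00_le cx => k; rewrite e.
by apply/eqP; rewrite eq_le; apply/andP; split; apply: N_mono => // k; rewrite e.
Qed.

Lemma N_single x k : (forall i, i <> k -> x i = 0) -> nT x = `|x k|.
Proof.
move=> xk; have xM : c00_bound x k.+1.
  by move=> i ki; apply: xk => e; move: ki; rewrite e ltnn.
have cx : c00 x by exists k.+1.
apply/eqP; rewrite eq_le N_ge_coord // andbT.
apply: (N_ub_proper xM) => [i|n F aF pr].
  by case: (eqVneq i k) => [->//|/eqP/xk ->]; rewrite normr0.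
rewrite big1 ?mulr_ge0 // => i _; rewrite (@card_supp0 _ k.+1 (restr (F i) x)) ?N0 //.
  exact: restr_bound.
apply/eqP; rewrite -leqn0 -ltnS; apply: leq_trans (pr i) _.
rewrite /card_supp big_ord_recr /= big1 ?add0n; first by case: eqP.
by move=> j _; rewrite xk ?eqxx // => e; have := ltn_ord j; rewrite e ltnn.
Qed.

Lemma N_unit_seq k : nT (unit_seq R k) = 1.
Proof.
rewrite (@N_single _ k) /unit_seq ?eqxx ?normr1 // => i.
by case: eqP.
Qed.

(** * Restrictions to consecutive intervals *)

Lemma slice_le u v x k : `|slice u v x k| <= `|x k|.
Proof. by rewrite /slice; case: ifP => // _; rewrite normr0. Qed.

Lemma slice_c00 u v x : c00 x -> c00 (slice u v x).
Proof. exact: c00_le (slice_le u v x). Qed.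

Lemma tail_le n x k : `|tail n x k| <= `|x k|.
Proof. by rewrite /tail; case: ifP => // _; rewrite normr0. Qed.

Lemma slice_sum_mono x y u s : c00 x -> (forall k, `|y k| <= `|x k|) ->
  slice_sum nT y u s <= slice_sum nT x u s.
Proof.
move=> cx yx; elim: s u => //= v s IH u; apply: lerD => //.
by apply: N_mono => [|k]; [exact: slice_c00 | rewrite /slice; case: ifP].
Qed.

Lemma slice_sumD x y u s : c00 x -> c00 y ->
  slice_sum nT (fun k => x k + y k) u s <= slice_sum nT x u s + slice_sum nT y u s.
Proof.
move=> cx cy; elim: s u => [|v s IH] u /=; first by rewrite addr0.
apply: le_trans (lerD _ (IH v)) _; last by rewrite addrACA.
rewrite (_ : slice u v _ = fun k => slice u v x k + slice u v y k).
  by apply: N_tri; apply: slice_c00.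
by apply/funext => k; rewrite /slice; case: ifP; rewrite ?addr0.
Qed.

Lemma slice_sumZ x (c : R) u s : c00 x ->
  slice_sum nT (fun k => c * x k) u s = `|c| * slice_sum nT x u s.
Proof.
move=> cx; elim: s u => [|v s IH] u /=; first by rewrite mulr0.
rewrite IH mulrDr; congr (_ + _); rewrite -NZ; last exact: slice_c00.
by congr nT; apply/funext => k; rewrite /slice; case: ifP; rewrite ?mulr0.
Qed.

Lemma slice_sum_cat x u s1 s2 :
  slice_sum nT x u (s1 ++ s2) = slice_sum nT x u s1 + slice_sum nT x (last u s1) s2.
Proof. by elim: s1 u => [|v s IH] u /=; rewrite ?add0r // IH addrA. Qed.

Lemma slice_sumE x u s : slice_sum nT x u s =
  \sum_(0 <= i < size s) nT (slice (nth 0%N (u :: s) i) (nth 0%N s i) x).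
Proof.
elim: s u => [|v s IH] u; first by rewrite big_nil.
by rewrite /= IH big_nat_recl.
Qed.

Lemma N_slice_restr u v x : slice u v x = restr (iota u (v - u)) x.
Proof.
apply/funext => k; rewrite /slice /restr mem_iota.
by congr (if _ then _ else _); apply/idP/idP; lia.
Qed.

(** With 0-based coordinates, up to u + 1 sets starting at u are admissible. *)
Lemma slice_sum_adm x u s : c00 x -> path leq u s -> (size s <= u.+1)%N ->
  slice_sum nT x u s <= 2 * nT x.
Proof.
move=> cx pu su; rewrite slice_sumE big_mkord.
have srt i j : (i <= j < (size s).+1)%N -> (nth 0 (u :: s) i <= nth 0 (u :: s) j)%N.
  move=> /andP[ij js]; apply: (sorted_leq_nth leq_trans leqnn 0%N (s:=u::s)) => //; rewrite inE /=; lia.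
under eq_bigr do rewrite N_slice_restr.
apply: (N_ge_adm (F := fun i : 'I_(size s) => iota (nth 0%N (u :: s) i) (nth 0%N s i - nth 0%N (u :: s) i))) => //.
split; first by move=> i; apply: iota_uniq.
split=> [i a|i j a b ij]; rewrite !mem_iota.
  have := srt 0%N i; rewrite leq0n ltnS (ltnW (ltn_ord i)) => /(_ isT) /=; lia.
have := srt i.+1 j; rewrite ij ltnS (ltnW (ltn_ord j)) => /(_ isT) /=; lia.
Qed.

(** The sets are enlarged to consecutive intervals by cutting one past the largest element met so
    far. *)
Lemma adm_cuts n (F : 'I_n -> seq nat) : admissible F ->
  exists u s, [/\ path leq u s, size s = n &
    forall x, c00 x -> \sum_(i < n) nT (restr (F i) x) <= slice_sum nT x u s].
Proof.
move=> [_ [aF lF]].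
(* The bound [n.-1] is the first coordinate open to an admissible family of n sets; it gives a sound
   cut even if the sets so far are empty. *)
pose c i := maxn n.-1 (\max_(j < n | (j <= i)%N) \max_(a <- F j) a.+1).
have cM i : (c i <= c i.+1)%N.
  rewrite /c geq_max leq_maxl /= leq_max; apply/orP; right.
  apply/bigmax_leqP => j ji; apply: (leq_trans _ (leq_bigmax_cond _ (leqW ji))) => //.
pose u := n.-1; exists u, (mkseq c n); rewrite size_mkseq.
have nthE i : (i < n)%N -> nth 0%N (u :: mkseq c n) i = if i is i'.+1 then c i' else u.
  by case: i => //= i ?; rewrite nth_mkseq // ltnW.
split=> //.
  apply/(pathP 0%N) => i; rewrite size_mkseq => i_n; rewrite nthE // nth_mkseq //.
  by case: i i_n => [|i] _; [rewrite leq_maxl | exact: cM].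
move=> x cx; rewrite slice_sumE size_mkseq big_mkord; apply: ler_sum => i _.
apply: N_mono => [|k]; first exact: slice_c00.
rewrite /restr; case: ifP => [kF|]; last by rewrite normr0.
rewrite /slice nthE // nth_mkseq //; have kn := aF _ _ kF.
rewrite ifT //; apply/andP; split; last first.
  rewrite leq_max; apply/orP; right.
  apply: (@leq_trans (\max_(a <- F i) a.+1)); first exact: (@leq_bigmax_seq _ _ xpredT (fun a => a.+1) k kF isT).
  exact: (@leq_bigmax_cond _ (fun j : 'I_n => (j <= i)%N) (fun j : 'I_n => \max_(a <- F j) a.+1)%N i).
case: i kF => -[|i] iN kF /=; first by rewrite /u; lia.
rewrite /c geq_max; apply/andP; split; first lia.
apply/bigmax_leqP => j ji; apply/bigmax_leqP_seq => a aj _.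
exact: (lF j (Ordinal iN) a k).
Qed.

Lemma slice_sum_zero x u s : path leq u s -> (forall k, (u <= k)%N -> x k = 0) ->
  slice_sum nT x u s = 0.
Proof.
elim: s u => //= v s IH u /andP[uv pv] xu.
rewrite IH ?addr0 // => [|k vk]; last by rewrite xu // (leq_trans uv).
rewrite (_ : slice u v x = fun=> 0) ?N0 //; apply/funext => k; rewrite /slice.
by case: ifP => // /andP[uk _]; apply: xu.
Qed.

(** Moving the cuts up to n makes n + 1 intervals admissible. *)
Lemma slice_sum_clip_low x n u s : (forall k, (k < n)%N -> x k = 0) ->
  slice_sum nT x u s = slice_sum nT x (maxn n u) (map (maxn n) s).
Proof.
move=> xn; elim: s u => //= v s IH u; rewrite IH; congr (nT _ + _).
apply/funext => k; rewrite /slice; case: (ltnP k n) => kn; last first.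
  by congr (if _ then _ else _); apply/idP/idP; lia.
by rewrite xn // !if_same.
Qed.

Lemma path_maxn n u s : path leq u s -> path leq (maxn n u) (map (maxn n) s).
Proof. by elim: s u => //= v s IH u /andP[uv /IH ->]; rewrite andbT; lia. Qed.

Lemma slice_whole x M : c00_bound x M -> slice 0 M x = x.
Proof.
by move=> xM; apply/funext => k; rewrite /slice leq0n /=; case: ltnP => // /xM.
Qed.

Lemma c00_bound_pair (f x : nat -> R) M M' : c00_bound x M -> (M <= M')%N ->
  \sum_(i < M') f i * x i = \sum_(i < M) f i * x i.
Proof.
move=> xM MM'; rewrite -!(big_mkord predT (fun i => f i * x i)) (big_cat_nat (leq0n M) MM') //=.
rewrite -[RHS]addr0; congr (_ + _); rewrite big_nat big1 // => i /andP[Mi _].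
by rewrite xM // mulr0.
Qed.

(** * Norms of tails of elements of the dual *)

Section Shrinking.
Variable f : nat -> R.

Definition has_pair x (c : R) :=
  exists2 M, c00_bound x M & \sum_(i < M) f i * x i = c.

Lemma has_pair_c00 x c : has_pair x c -> c00 x.
Proof. by case=> M xM _; exists M. Qed.

Lemma has_pairD x y c d : has_pair x c -> has_pair y d ->
  has_pair (fun k => x k + y k) (c + d).
Proof.
move=> [M xM <-] [M' yM' <-]; exists (maxn M M').
  by move=> i; rewrite geq_max => /andP[a b]; rewrite xM // yM' // addr0.
rewrite -(c00_bound_pair f xM (leq_maxl M M')) -(c00_bound_pair f yM' (leq_maxr M M')).
by rewrite -big_split; apply: eq_bigr => i _; rewrite mulrDr.
Qed.

Lemma has_pairZ x c d : has_pair x c -> has_pair (fun k => d * x k) (d * c).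
Proof.
move=> [M xM <-]; exists M; first by move=> i Mi; rewrite xM // mulr0.
by rewrite mulr_sumr; apply: eq_bigr => i _; rewrite mulrCA.
Qed.

(** Unlike admissibility, this does not tie the number of intervals to the place where they
    start. *)
Definition flat (t : R) n x :=
  forall u s, path leq u s -> (size s <= n)%N -> slice_sum nT x u s <= t.

(** A family of at most K sets may see both parts, but by flatness its sum over w is at most t,
    which the factor 1/2 of the norm turns into t / 2. A family of more than K sets starts after Z
    and sees w only. *)
Lemma N_straddle (Z w : nat -> R) K t n u v : c00_bound Z K -> c00 w ->
  (forall k, (k < K)%N -> w k = 0) -> flat t n w -> (K <= n)%N -> (0 < n)%N ->
  (u <= v)%N ->
  nT (slice u v (fun k => Z k + w k)) <= Num.max t (nT (slice u v Z) + t / 2).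
Proof.
move=> ZK cw wK fw Kn n0 uv; have cZ : c00 Z by exists K.
have t0 : 0 <= t by have := fw 0%N [::]; apply.
have Nw : nT (slice u v w) <= t by have := fw u [:: v]; rewrite /= uv addr0; apply.
have cE := slice_c00 u v (c00D cZ cw).
have E : slice u v (fun k => Z k + w k) = fun k => slice u v Z k + slice u v w k.
  by apply/funext => k; rewrite /slice; case: ifP; rewrite ?addr0.
have B1 : t <= Num.max t (nT (slice u v Z) + t / 2) by rewrite le_max lexx.
have B2 : nT (slice u v Z) + t / 2 <= Num.max t (nT (slice u v Z) + t / 2).
  by rewrite le_max lexx orbT.
apply: N_ub => // [k|m F aF]; rewrite E.
  rewrite le_max; case: (ltnP k K) => kK.
    apply/orP; right; rewrite {2}/slice wK // if_same addr0.
    have := N_ge_coord k (slice_c00 u v cZ); lra.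
  apply/orP; left; rewrite {1}/slice ZK // if_same add0r.
  exact: le_trans (N_ge_coord k (slice_c00 u v cw)) Nw.
have spl : \sum_(i < m) nT (restr (F i) (fun k => slice u v Z k + slice u v w k)) <=
   \sum_(i < m) nT (restr (F i) (slice u v Z)) + \sum_(i < m) nT (restr (F i) (slice u v w)).
  rewrite -big_split; apply: ler_sum => i _ /=.
  rewrite (_ : restr (F i) _ =
      fun k => restr (F i) (slice u v Z) k + restr (F i) (slice u v w) k).
    by apply: N_tri; apply: restr_c00; apply: slice_c00.
  by apply/funext => k; rewrite /restr; case: ifP; rewrite ?addr0.
apply: le_trans spl _; have [mK|Km] := leqP m K.
  have [a [s [ps ss Hs]]] := adm_cuts aF.
  have := Hs _ (slice_c00 u v cw).
  have := slice_sum_mono a s cw (slice_le u v w).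
  have := fw a s ps; rewrite ss => /(_ (leq_trans mK Kn)).
  have := N_ge_adm (slice_c00 u v cZ) aF.
  lra.
rewrite big1 ?add0r => [|i _]; last first.
  rewrite (_ : restr _ _ = fun=> 0) ?N0 //; apply/funext => k; rewrite /restr.
  case: ifP => // ki; rewrite /slice; case: ifP => // _; apply: ZK.
  have [_ [H _]] := aF; have := H _ _ ki; lia.
have := N_ge_adm (slice_c00 u v cw) aF.
lra.
Qed.

(* At most one interval straddles K; it costs t / 2 only, because w is flat on
   families that start before K. *)
Lemma slice_sum_add_flat (Z w : nat -> R) K t n n' : c00_bound Z K -> c00 w ->
  (forall k, (k < K)%N -> w k = 0) -> flat t n' w -> (K <= n')%N -> (n <= n')%N ->
  forall s u, path leq u s -> (size s <= n)%N ->
  slice_sum nT (fun k => Z k + w k) u s <= slice_sum nT Z u s + t / 2 \/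
  exists s1, [/\ path leq u s1, (size s1 < size s)%N &
    slice_sum nT (fun k => Z k + w k) u s <= slice_sum nT Z u s1 + t].
Proof.
move=> ZK cw wK fw Kn nn'; have cZ : c00 Z by exists K.
have t0 : 0 <= t by have := fw 0%N [::]; apply.
elim=> [|v s IH] u; first by move=> _ _; left => /=; lra.
move=> /= /andP[uv ps] sn; case: (leqP v K) => vK.
  have E : slice u v (fun k => Z k + w k) = slice u v Z.
    apply/funext => k; rewrite /slice; case: ifP => // /andP[_ kv].
    by rewrite wK ?addr0 //; apply: leq_trans vK.
  rewrite E; case: (IH v ps (ltnW sn)) => [H|[s1 [p1 l1 H]]]; first by left; lra.
  right; exists (v :: s1); split=> //=; first by rewrite uv.
  by lra.
case: s => [|v' s] in IH ps sn *.
  rewrite /= !addr0; have := N_straddle ZK cw wK fw Kn (leq_trans sn nn') uv.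
  rewrite le_max => /orP[H|H]; last by left.
  by right; exists [::]; split=> //=; lra.
(* The later intervals start beyond K and miss Z, so one interval is enough for Z; w costs t in all,
   and at least one interval is saved. *)
right; exists [:: v]; split=> //=; first by rewrite uv.
have := slice_sumD u (v :: v' :: s) cZ cw.
have := fw u (v :: v' :: s); rewrite /= uv => /(_ ps (leq_trans sn nn')).
have := @slice_sum_zero Z v (v' :: s) ps; rewrite /= => H.
have -> := H _; last by move=> k vk; apply: ZK; apply: leq_trans (ltnW vK) vk.
lra.
Qed.

Definition flat_far t := forall M n,
  exists w, [/\ has_pair w 1, (forall k, (k < M)%N -> w k = 0) & flat t n w].

(** Each new vector starts after the end K of the sum so far and is flat for at least K intervals.
    It costs t / 2, or t together with the loss of an interval; the term [size s] pays for the
    second case. *)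
Lemma flat_far_sum t : flat_far t -> forall M n m,
  exists Z, [/\ has_pair Z m%:R, (forall k, (k < M)%N -> Z k = 0) &
    forall u s, path leq u s -> (size s <= n)%N ->
      slice_sum nT Z u s <= t * (m%:R / 2 + (size s)%:R)].
Proof.
move=> G M n; have t0 : 0 <= t.
  by have [w [_ _ H]] := G 0%N 0%N; have := H 0%N [::]; apply.
elim=> [|m [Z [hZ ZM CZ]]].
  exists (fun=> 0); split=> // [|u s _ _].
    by exists 0%N => //; rewrite big_ord0.
  rewrite slice_sumE big1 => [|i _]; first by rewrite mul0r add0r mulr_ge0.
  by rewrite (_ : slice _ _ _ = fun=> 0) ?N0 //; apply/funext => k; rewrite /slice if_same.
have [K ZK _] := hZ.
have [w [hw wM fw]] := G (maxn M K) (maxn n K).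
exists (fun k => Z k + w k); split.
- by rewrite -[m.+1%:R]natr1; apply: has_pairD.
- by move=> k kM; rewrite ZM // wM ?addr0 // leq_max kM.
move=> u s ps sn.
have := slice_sum_add_flat ZK (has_pair_c00 hw) _ fw (leq_maxr _ _) (leq_maxl _ _) ps sn.
case=> [k kK|H|[s1 [p1 l1 H]]]; first by rewrite wM // leq_max kK orbT.
  by have := CZ u s ps sn; rewrite -[m.+1%:R]natr1; lra.
have := CZ u s1 p1 (leq_trans (ltnW l1) sn).
have : (size s1)%:R + 1 <= (size s)%:R :> R by rewrite natr1 ler_nat.
move=> H1 H2; have := ler_wpM2l t0 H1; rewrite -[m.+1%:R]natr1; lra.
Qed.

(** Average m = 4 (n + 1) vectors: t (m / 2 + n) divided by m is at most 3 t / 4. *)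
Lemma flat_far_step t : flat_far t -> flat_far (3 / 4 * t).
Proof.
move=> G M n; set m := (4 * n.+1)%N.
have t0 : 0 <= t.
  by have [w [_ _ H]] := G 0%N 0%N; have := H 0%N [::]; apply.
have [Z [hZ ZM CZ]] := flat_far_sum G M n m.
have m0 : 0 < m%:R :> R by rewrite ltr0n.
exists (fun k => m%:R^-1 * Z k); split.
- by have := has_pairZ m%:R^-1 hZ; rewrite mulVf // gt_eqF.
- by move=> k kM; rewrite ZM ?mulr0.
move=> u s ps sn; rewrite slice_sumZ; last exact: has_pair_c00 hZ.
rewrite ger0_norm ?invr_ge0 ?ler0n // ler_pdivrMl //.
apply: le_trans (CZ _ _ ps sn) _.
have : (size s)%:R <= n.+1%:R :> R by rewrite ler_nat leqW.
have -> : m%:R = 4 * n.+1%:R :> R by rewrite natrM.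
move=> H; have := ler_wpM2l t0 H; lra.
Qed.

Lemma flat_far_small t e : flat_far t -> 0 < e -> exists2 t', t' < e & flat_far t'.
Proof.
move=> G e0; have t0 : 0 <= t.
  by have [w [_ _ H]] := G 0%N 0%N; have := H 0%N [::]; apply.
have Gk k : flat_far ((3 / 4) ^+ k * t).
  elim: k => [|k IH]; first by rewrite expr0 mul1r.
  by rewrite exprS -mulrA; apply: flat_far_step.
(* Here k > 3 t / e, so that (4/3)^k >= 1 + k / 3 > t / e. *)
have := archi_boundP (divr_ge0 (mulr_ge0 (ler0n R 3) t0) (ltW e0)).
set k := Num.Def.archi_bound _ => kP; exists ((3 / 4) ^+ k * t) => //.
have b : 1 + k%:R / 3 <= (4 / 3) ^+ k :> R.
  have := @bernoulli R (1 / 3) k; rewrite (_ : 1 + 1 / 3 = 4 / 3 :> R); last lra.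
  move=> H; apply: le_trans (H _); lra.
have p0 : 0 < (4 / 3) ^+ k :> R by rewrite exprn_gt0 //; lra.
have pE : (3 / 4) ^+ k * (4 / 3) ^+ k = 1 :> R.
  by rewrite -exprMn (_ : 3 / 4 * (4 / 3) = 1 :> R) ?expr1n //; lra.
rewrite ltr_pdivrMr // in kP.
have : t < e * (4 / 3) ^+ k.
  have := ler_wpM2l (ltW e0) b; lra.
rewrite -(ltr_pM2l (_ : 0 < (3 / 4) ^+ k)); last by rewrite exprn_gt0 //; lra.
by rewrite mulrCA pE mulr1.
Qed.

(** If every tail of f were large, there would be vectors arbitrarily far out with pairing 1 and
    norm at most 1 / e. Iterated averaging makes their norm as small as desired while the pairing
    stays 1, against the bound B. *)
Lemma dual_shrinking B e : dual_le nT f B -> 0 < e -> exists n, dual_le nT (tail n f) e.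
Proof.
move=> fB e0; apply: contrapT => H.
have Hn n : exists w, [/\ has_pair w 1, (forall k, (k < n)%N -> w k = 0) & nT w <= e^-1].
  have : ~ dual_le nT (tail n f) e by move=> ?; apply: H; exists n.
  move=> /existsNP[x] /existsNP[M] /not_implyP[xM] /negP; rewrite -ltNge => lt.
  have cx : c00 x by exists M.
  set p := \sum_(i < M) _ in lt.
  have p0 : 0 < p by apply: le_lt_trans lt; rewrite mulr_ge0 ?N_ge0 // ltW.
  have ctx : c00 (tail n x) by apply: c00_le cx; apply: tail_le.
  exists (fun k => p^-1 * tail n x k); split.
  - rewrite -(mulVf (lt0r_neq0 p0)); apply: has_pairZ; exists M.
      exact: c00_bound_le (tail_le n x) xM.
    by apply: eq_bigr => i _; rewrite /tail; case: ifP; rewrite ?mulr0 ?mul0r.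
  - by move=> k kn; rewrite /tail leqNgt kn mulr0.
  rewrite NZ // ger0_norm; last by rewrite invr_ge0 ltW.
  rewrite ler_pdivrMl //.
  rewrite ler_pdivlMr // mulrC; apply: le_trans (ltW lt).
  by apply: (ler_wpM2l (ltW e0)); apply: N_mono => // k; apply: tail_le.
(* Any n intervals beyond coordinate n are admissible, so their sum is at most twice the norm. *)
have G : flat_far (2 / e).
  move=> M n; have [w [hw wM wN]] := Hn (maxn M n); exists w; split=> //.
    by move=> k kM; rewrite wM // leq_max kM.
  move=> u s ps sn; rewrite (@slice_sum_clip_low w n) => [|k kn]; last by rewrite wM // leq_max kn orbT.
  apply: le_trans (slice_sum_adm (has_pair_c00 hw) (path_maxn n ps) _) _; last lra.
  by rewrite size_map; lia.
have B1 : 0 < `|B| + 1 by rewrite ltr_wpDl.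
have eB : 0 < (`|B| + 1)^-1 by rewrite invr_gt0.
have [t tB Gt] := flat_far_small G eB.
have [w [[K wK hw] _ fw]] := Gt 0%N 1%N.
have cw : c00 w by exists K.
have := fw 0%N [:: K]; rewrite /= addr0 slice_whole // => /(_ isT isT) wt.
have := fB w K wK; rewrite hw => H1.
have : B * nT w <= (`|B| + 1) * t.
  apply: (@le_trans _ _ ((`|B| + 1) * nT w)); last by apply: (ler_wpM2l (ltW B1)).
  apply: ler_wpM2r; first exact: N_ge0.
  by have := ler_norm B; lra.
rewrite -(ltr_pM2l B1) mulfV ?gt_eqF // in tB; lra.
Qed.
End Shrinking.

(** * Lower estimates for disjoint vectors *)

Lemma N_slice_split x u w v : c00 x -> (u <= w <= v)%N ->
  nT (slice u v x) <= nT (slice u w x) + nT (slice w v x).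
Proof.
move=> cx uwv; rewrite (_ : slice u v x = fun k => slice u w x k + slice w v x k).
  by apply: N_tri; apply: slice_c00.
apply/funext => k; rewrite /slice; case: (ltnP k w) => kw.
  by rewrite /= addr0; congr (if _ then _ else _); apply/idP/idP; lia.
by rewrite andbF add0r; congr (if _ then _ else _); apply/idP/idP; lia.
Qed.

(** Cuts are clamped to [u, v] and repetitions dropped. Strictness lets [slice_sum_group] bound end
    points below by the number of intervals. *)
Lemma slice_sum_clip x u v cs a : c00 x -> (u <= v)%N -> path leq a cs ->
  exists cs', [/\ path ltn (minn (maxn a u) v) cs', all (fun c => c <= v)%N cs',
    (size cs' <= size cs)%N &
    slice_sum nT (slice u v x) a cs <= slice_sum nT x (minn (maxn a u) v) cs'].
Proof.
move=> cx uv; elim: cs a => [|c cs IH] a; first by exists [::].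
move=> /= /andP[ac pc]; have [cs' [p' a' s' H]] := IH c pc.
have [e|ne] := eqVneq (minn (maxn a u) v) (minn (maxn c u) v).
  exists cs'; rewrite e; split=> //; first exact: leqW.
  rewrite (_ : slice a c (slice u v x) = fun=> 0) ?N0 ?add0r //.
  apply/funext => k; rewrite /slice; case: ifP => // k1; case: ifP => // k2.
  by exfalso; lia.
exists (minn (maxn c u) v :: cs'); split=> //=.
- by rewrite p' andbT; lia.
- by rewrite a' andbT; lia.
rewrite lerD // (_ : slice a c (slice u v x) = slice (minn (maxn a u) v) (minn (maxn c u) v) x) //.
apply/funext => k; rewrite /slice.
have -> : (minn (maxn a u) v <= k < minn (maxn c u) v)%N = ((a <= k < c) && (u <= k < v))%N.
  by apply/idP/idP; lia.
by case: (a <= k < c)%N.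
Qed.

Lemma slice_sum_slice x u0 u v s : (u0 <= u)%N -> path leq u s -> all (fun c => c <= v)%N s ->
  slice_sum nT (slice u0 v x) u s = slice_sum nT x u s.
Proof.
elim: s u => //= c s IH u u0u /andP[uc pc] /andP[cv av].
rewrite IH // ?(leq_trans u0u) //; congr (nT _ + _).
apply/funext => k; rewrite /slice; case: ifP => // k1.
by rewrite ifT //; lia.
Qed.

Lemma ltn_path_last u s : path ltn u s -> (u + size s <= last u s)%N.
Proof.
elim: s u => [|c s IH] u /=; first by rewrite addn0.
by move=> /andP[uc /IH]; lia.
Qed.

(* Consecutive groups of b, 2b, 4b, ... intervals are all admissible, because
   the left end point at least doubles from one group to the next. *)
Lemma slice_sum_group x : c00 x -> forall s u b v, path ltn u s ->
  all (fun c => c <= v)%N s -> (u <= v)%N -> (0 < b <= u.+1)%N ->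
  exists s' t, [/\ path leq u s', last u s' = v, size s' = t.+1,
    (2 ^ t * b <= v.+1)%N /\ (2 ^ t * b <= b + size s)%N &
    slice_sum nT x u s <= 2 * slice_sum nT x u s'].
Proof.
move=> cx s; have [m] := ubnP (size s); elim: m s => // m IH s sm u b v ps av uv bu.
have pl : path leq u s by apply: sub_path ps => i j /ltnW.
have [sb|bs] := leqP (size s) b.
  exists [:: v], 0%N; rewrite /= uv expn0 mul1n; split=> //; first lia.
  rewrite addr0 -(slice_sum_slice x (leqnn u) pl av); apply: slice_sum_adm => //.
    exact: slice_c00.
  lia.
have es : s = take b s ++ drop b s by rewrite cat_take_drop.
set w := last u (take b s).
have [pt pd] : path ltn u (take b s) /\ path ltn w (drop b s).
  by apply/andP; rewrite -cat_path -es.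
have szt : size (take b s) = b by rewrite size_takel // ltnW.
(* Strictly increasing cuts advance by at least b over b intervals; with b <= u + 1 this gives 2 b
   <= w + 1, so the next group may be twice as long. *)
have wb : (u + b <= w)%N by have := ltn_path_last pt; rewrite szt.
have [at_ ad] : all (fun c => c <= v)%N (take b s) /\ all (fun c => c <= v)%N (drop b s).
  by apply/andP; rewrite -all_cat -es.
have wv : (w <= v)%N.
  rewrite /w; case: (take b s) at_ => // c t; move/allP; apply; exact: mem_last.
have sd : (size (drop b s) < m)%N by rewrite size_drop; lia.
have [s' [t [p' l' z' [t1 t2] H]]] := IH _ sd w (2 * b)%N v pd ad wv ltac:(lia).
exists (w :: s'), t.+1; split=> //=; first by rewrite p' andbT; move: wb; clear; lia.
- by rewrite z'.
- by rewrite expnSr -mulnA; split=> //; move: t2 bs; rewrite size_drop; move: (2 ^ t * (2 * b))%N => A; clear; lia.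
rewrite {1}es slice_sum_cat -/w mulrDr lerD //.
have plt : path leq u (take b s) by apply: sub_path pt => i j /ltnW.
have atw : all (fun c => c <= w)%N (take b s).
  apply/allP => c cs; have srt : sorted leq (u :: take b s) by [].
  rewrite /w (last_nth 0%N) -[c](nth_index 0%N cs).
  rewrite -[nth _ _ (index _ _)]/(nth 0 (u :: take b s) (index c (take b s)).+1)%N.
  apply: (sorted_leq_nth leq_trans leqnn 0%N srt); rewrite ?inE //= ?ltnS ?index_mem //.
rewrite -(slice_sum_slice x (leqnn u) plt atw); apply: slice_sum_adm => //; first exact: slice_c00.
by rewrite szt; case/andP: bu.
Qed.

(** The cuts k and k + 1 isolate coordinate k, where the gain is a; refining an interval does not
    decrease the sum, by the triangle inequality. *)
Lemma slice_sum_insert x x' k a : c00 x -> (forall i, 0 <= x' i <= x i) ->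
  0 <= a -> x' k + a <= x k -> forall cs u, path leq u cs -> (u <= k)%N ->
  exists cs', [/\ path leq u cs', (size cs' <= size cs + 2)%N &
    slice_sum nT x' u cs + a <= slice_sum nT x u cs'].
Proof.
move=> cx xx a0 xk cs.
have le i : `|x' i| <= `|x i|.
  by have /andP[h0 h1] := xx i; rewrite !ger0_norm // (le_trans h0).
have cx' : c00 x' := c00_le le cx.
have lei u v i : `|slice u v x' i| <= `|slice u v x i| by rewrite /slice; case: ifP.
have Nk y : nT (slice k k.+1 y) = `|y k|.
  rewrite (@N_single _ k); first by rewrite /slice leqnn ltnSn.
  by move=> i ik; rewrite /slice; case: ifP => //; lia.
have Nx : nT (slice k k.+1 x') + a <= nT (slice k k.+1 x).
  have /andP[h0 h1] := xx k.
  by rewrite !Nk !ger0_norm //; lra.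
elim: cs => [|c cs IH] u /=.
  move=> _ uk; exists [:: k; k.+1]; split=> //=; first by rewrite uk leqnSn.
  have h1 := N_ge0 (slice_c00 u k cx); have h2 := N_ge0 (slice_c00 k k.+1 cx').
  lra.
move=> /andP[uc pc] uk; case: (leqP c k) => ck.
  have [cs' [p' s' H]] := IH c pc ck; exists (c :: cs'); split=> //=.
    by rewrite uc.
  have := N_mono (slice_c00 u c cx) (lei u c); lra.
exists [:: k, k.+1, c & cs]; split=> //=; first by rewrite uk leqnSn ck.
  by rewrite addn2.
have h1 : nT (slice u c x') <= nT (slice u k x') + nT (slice k c x').
  by apply: N_slice_split => //; lia.
have h2 : nT (slice k c x') <= nT (slice k k.+1 x') + nT (slice k.+1 c x').
  by apply: N_slice_split => //; lia.
have h3 := N_mono (slice_c00 u k cx) (lei u k).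
have h4 := N_mono (slice_c00 k.+1 c cx) (lei k.+1 c).
have h5 := slice_sum_mono c cs cx le.
lra.
Qed.

(** Otherwise all coordinates and all shrinking families would stay below the fraction l, and
    [N_ub_proper] would bound the norm of y by l times itself. *)
Lemma N_split_or_coord y M (l : R) : c00_bound y M -> 0 <= l < 1 ->
  (exists k, l * nT y <= `|y k|) \/
  exists n (F : 'I_n -> seq nat), [/\ (0 < n)%N, admissible F,
    forall i, (card_supp M (restr (F i) y) < card_supp M y)%N &
    2 * (l * nT y) <= \sum_(i < n) nT (restr (F i) y)].
Proof.
move=> yM /andP[l0 l1]; have cy : c00 y by exists M.
have [e|ne] := eqVneq (nT y) 0; first by left; exists 0%N; rewrite e mulr0.
have Np : 0 < nT y by rewrite lt_neqAle eq_sym ne N_ge0.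
apply: contrapT => /not_orP[H1 H2].
have : nT y <= l * nT y; last first.
  by have := ltr_pM2r Np l 1; rewrite mul1r l1; case: ltgtP => //; lra.
apply: (N_ub_proper yM) => [k|n F aF pr].
  by rewrite leNgt; apply/negP => /ltW h; apply: H1; exists k.
case: n F aF pr => [|n] F aF pr; first by rewrite big_ord0 !mulr_ge0 // ltW.
by rewrite leNgt; apply/negP => /ltW h; apply: H2; exists n.+1, F.
Qed.

(* c is the loss caused by not attaining the suprema that define the norm; it is
   arbitrarily close to 1. *)
Definition intervals_bound (c : R) (s : nat) := forall M x (ys : seq (nat -> R)),
  c00_bound x M -> {in ys, forall y, (card_supp M y <= s)%N} ->
  (forall k, \sum_(y <- ys) `|y k| <= x k) ->
  exists cs, [/\ path leq 0%N cs, (size cs <= 4 * size ys)%N &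
    c * \sum_(y <- ys) nT y <= slice_sum nT x 0 cs].

Lemma le_sum_seq (T : eqType) (ts : seq T) (f : T -> R) t :
  (forall t', 0 <= f t') -> t \in ts -> f t <= \sum_(t' <- ts) f t'.
Proof.
move=> f0 tt; rewrite (perm_big _ (perm_to_rem tt)) big_cons /= lerDl.
by apply: sumr_ge0.
Qed.

Lemma fam_bound x M (ys : seq (nat -> R)) : c00_bound x M ->
  (forall k, \sum_(y <- ys) `|y k| <= x k) -> {in ys, forall y, c00_bound y M}.
Proof.
move=> xM H y yy i Mi; apply/eqP; rewrite -normr_le0 -(xM i Mi).
apply: le_trans (H i).
by apply: (@le_sum_seq _ ys (fun z => `|z i|)).
Qed.

(** The bound for s gives at most 4 S intervals for the parts in [u, v). Grouping them with b = u +
    1 leaves t + 1 intervals, where 2^t (u + 1) <= u + 1 + 4 S <= 5 S. *)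
Lemma intervals_segment c s M x zs u v S : 0 <= c -> intervals_bound c s ->
  (u <= v)%N -> c00_bound x M -> {in zs, forall z, (card_supp M z <= s)%N} ->
  (forall k, \sum_(z <- zs) `|z k| <= x k) -> (size zs <= S)%N -> (u < S)%N ->
  exists s' t, [/\ path leq u s', last u s' = v, size s' = t.+1,
    (2 ^ t * u.+1 <= v.+1)%N /\ (2 ^ t * u.+1 <= 5 * S)%N &
    c * \sum_(z <- zs) nT (slice u v z) <= 2 * slice_sum nT x u s'].
Proof.
move=> c0 U uv xM zss zx zS uS; have cx : c00 x by exists M.
have [|||cs [pc sc H]] := U M (slice u v x) (map (slice u v) zs).
- exact: c00_bound_le (slice_le u v x) xM.
- move=> _ /mapP[z zz ->]; apply: leq_trans (zss _ zz).
  by apply: card_supp_le => k zk; rewrite /slice zk if_same.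
- move=> k; rewrite big_map /slice; case: ifP => _; first exact: zx.
  by rewrite big1 // => z _; rewrite normr0.
rewrite big_map size_map in H sc.
have [cs1 [p1 a1 s1 H1]] := slice_sum_clip cx uv pc.
rewrite max0n (minn_idPl uv) in p1 H1.
have [s' [t [p' l' z' [t1 t2] H2]]] := slice_sum_group cx p1 a1 uv (ltac:(lia) : (0 < u.+1 <= u.+1)%N).
exists s', t; split=> //; last exact: le_trans H (le_trans H1 H2).
have s2 : (size cs1 <= 4 * S)%N.
  by apply: leq_trans s1 (leq_trans sc _); rewrite leq_mul2l.
by split=> //; move: t2 s2 uS; move: (2 ^ t * u.+1)%N (size cs1) => A B; clear; lia.
Qed.

(* The families in rest start one after the other; Z collects the pieces already
   started at u, at most S many.  The invariant 2 ^ (size cs) * u.+1 <= 16 ^ _ * S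
   is what makes the number of intervals linear in the number of families. *)
Lemma intervals_sweep c s M x : 0 <= c -> intervals_bound c s -> c00_bound x M ->
  forall (rest : seq (nat * seq (nat -> R))) (Z : seq (nat -> R)) u S,
  (size Z <= S)%N -> (u < S)%N -> path leq u (map fst rest) ->
  {in rest, forall p, (size p.2 <= p.1.+1)%N /\
    {in p.2, forall z, (card_supp M z <= s)%N /\ forall k, (k < p.1)%N -> z k = 0}} ->
  {in Z, forall z, (card_supp M z <= s)%N} ->
  (forall k, \sum_(z <- Z) `|z k| + \sum_(p <- rest) \sum_(z <- p.2) `|z k| <= x k) ->
  exists cs, [/\ path leq u cs,
    (2 ^ (size cs) * u.+1 <= 16 ^ (size rest).+1 * S)%N &
    c * (\sum_(z <- Z) nT (tail u z) + \sum_(p <- rest) \sum_(z <- p.2) nT z)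
      <= 2 * slice_sum nT x u cs].
Proof.
move=> c0 U xM; have cx : c00 x by exists M.
elim=> [|[v ps] rest IH] Z u S ZS uS /=.
  move=> _ _ Zs Zx.
  have {}Zx k : \sum_(z <- Z) `|z k| <= x k by have := Zx k; rewrite big_nil addr0.
  have [s' [t [p' l' z' [t1 t2] H]]] :=
    intervals_segment c0 U (leq_maxr M u) xM Zs Zx ZS uS.
  exists s'; split=> //; first by rewrite z' expnS expn1; lia.
  rewrite big_nil addr0; apply: le_trans H; apply: ler_wpM2l => //.
  rewrite !big_seq; apply: ler_sum => z zZ.
  rewrite (_ : tail u z = slice u (maxn M u) z) //; apply/funext => k.
  rewrite /tail /slice; case: leqP => //= uk; case: ltnP => // k1.
  by rewrite (fam_bound xM Zx zZ) //; lia.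
move=> /andP[uv pr] Hr Zs Zx.
have [psv psH] := Hr (v, ps) (mem_head _ _).
have Zx1 k : \sum_(z <- Z) `|z k| <= x k.
  apply: le_trans (Zx k); rewrite lerDl.
  by apply: sumr_ge0 => p _; apply: sumr_ge0.
have [s' [t [p' l' z' [t1 t2] H]]] := intervals_segment c0 U uv xM Zs Zx1 ZS uS.
(* From v on, the pieces of the family starting there are active too. *)
have [|||||cs [pc tc Hc]] := IH (Z ++ ps) v (S + v.+1)%N _ _ pr.
- by rewrite size_cat; apply: leq_add.
- lia.
- by move=> p pp; apply: Hr; rewrite inE pp orbT.
- by move=> z; rewrite mem_cat => /orP[/Zs //|/psH[]].
- by move=> k; have := Zx k; rewrite big_cat big_cons addrA.
exists (s' ++ cs); split.
- by rewrite cat_path p' l'.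
- rewrite size_cat z' expnD (expnS 2 t) (expnS 16 (size rest).+1).
  move: tc; set T := (2 ^ size cs)%N; set Q := (16 ^ _)%N; set A := (2 ^ t)%N in t1 t2 *.
  (* After multiplying by v + 1: A (u + 1) is at most v + 1 and at most 5 S, so (S + v + 1) A (u +
     1) <= 6 S (v + 1), and 2 * 6 <= 16. *)
  move=> tc; rewrite -(leq_pmul2r (ltn0Sn v)).
  have a1 : (T * v.+1 * (A * u.+1) <= Q * (S + v.+1) * (A * u.+1))%N by rewrite leq_mul2r tc orbT.
  have a2 : (S * (A * u.+1) <= S * v.+1)%N by rewrite leq_mul2l t1 orbT.
  have a3 : (v.+1 * (A * u.+1) <= v.+1 * (5 * S))%N by rewrite leq_mul2l t2 orbT.
  have a4 : (Q * ((S + v.+1) * (A * u.+1)) <= Q * (6 * (S * v.+1)))%N.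
    by rewrite leq_mul2l mulnDl; apply/orP; right; lia.
  move: a1 a4; clear; lia.
rewrite slice_sum_cat l' big_cons.
have h1 : \sum_(z <- Z) nT (tail u z) <=
    \sum_(z <- Z) nT (slice u v z) + \sum_(z <- Z) nT (tail v z).
  rewrite -big_split !big_seq; apply: ler_sum => z zZ /=.
  have cz : c00 z by exists M; exact: (fam_bound xM Zx1 zZ).
  rewrite (_ : tail u z = fun k => slice u v z k + tail v z k).
    by apply: N_tri; [exact: slice_c00 | apply: c00_le cz; exact: tail_le].
  apply/funext => k; rewrite /tail /slice; case: (ltnP k v) => kv.
    by rewrite andbT addr0.
  by rewrite andbF add0r (leq_trans uv kv).
have h2 : \sum_(z <- ps) nT (tail v z) = \sum_(z <- ps) nT z.
  rewrite !big_seq; apply: eq_bigr => z zp; congr nT; apply/funext => k.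
  by rewrite /tail; case: leqP => // kv; rewrite (psH z zp).2.
rewrite big_cat h2 /= in Hc.
have := ler_wpM2l c0 h1; lra.
Qed.

(** Each entry of L is an admissible family with its starting point. Sorted by starting points, the
    first family is the initial active one of the sweep. *)
Lemma intervals_pieces c s M x (L : seq (nat * seq (nat -> R))) :
  0 <= c -> intervals_bound c s -> c00_bound x M ->
  {in L, forall p, (size p.2 <= p.1.+1)%N /\
    {in p.2, forall z, (card_supp M z <= s)%N /\ forall k, (k < p.1)%N -> z k = 0}} ->
  (forall k, \sum_(p <- L) \sum_(z <- p.2) `|z k| <= x k) ->
  exists cs, [/\ path leq 0%N cs, (size cs <= 4 * size L)%N &
    c * (\sum_(p <- L) \sum_(z <- p.2) nT z) <= 2 * slice_sum nT x 0 cs].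
Proof.
move=> c0 U xM HL Lx; have cx : c00 x by exists M.
pose r := [rel p q : nat * seq (nat -> R) | (p.1 <= q.1)%N].
have srt : sorted leq (map fst (sort r L)).
  by rewrite sorted_map; apply: sort_sorted => p q; apply: leq_total.
have pe : perm_eq (sort r L) L by rewrite perm_sort.
have szE := perm_size pe.
case E : (sort r L) srt pe szE => [|[u ps] rest] srt pe szE.
  exists [::]; split=> //.
  by rewrite -(perm_big _ pe) big_nil mulr0 mulr0.
have HL' : {in (u, ps) :: rest, forall p, (size p.2 <= p.1.+1)%N /\
    {in p.2, forall z, (card_supp M z <= s)%N /\ forall k, (k < p.1)%N -> z k = 0}}.
  by move=> p; rewrite (perm_mem pe) => /HL.
have [ps1 ps2] := HL' _ (mem_head _ _).
have [||||cs [pc tc H]] := intervals_sweep c0 U xM ps1 (ltnSn u) _ _ _ _ (rest := rest).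
- exact: srt.
- by move=> p pp; apply: HL'; rewrite inE pp orbT.
- by move=> z /ps2[].
- by move=> k; have := Lx k; rewrite -(perm_big _ pe) big_cons.
exists cs; split.
- by case: cs pc {tc H} => //= v cs /andP[_ ->].
(* Here S = u + 1 cancels, and 16 = 2^4 leaves four intervals per family. *)
- move: tc; rewrite leq_pmul2r // -/(expn 2 4) (_ : 16 = 2 ^ 4)%N // -expnM leq_exp2l //.
  by rewrite -szE.
rewrite -(perm_big _ pe) big_cons /=.
rewrite (_ : \sum_(z <- ps) nT z = \sum_(z <- ps) nT (tail u z)); last first.
  rewrite !big_seq; apply: eq_bigr => z zp; congr nT; apply/funext => k.
  by rewrite /tail; case: leqP => // kv; rewrite (ps2 z zp).2.
apply: le_trans H _; apply: ler_wpM2l => //.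
case: cs {pc tc} => //= v cs; rewrite lerD2r; apply: N_mono => [|k]; first exact: slice_c00.
by rewrite /slice; case: (ltnP k v) => kv; rewrite ?andbF ?andbT //=; case: ifP; rewrite ?normr0.
Qed.

(** Each y is replaced by an almost norming coordinate, or by an almost norming admissible family of
    pieces with smaller supports, to which the bound for s applies. *)
Lemma intervals_step l c s : 0 <= l < 1 -> 0 <= c <= 1 ->
  intervals_bound c s -> intervals_bound (l * c) s.+1.
Proof.
move=> l01 /andP[c0 c1] U M x ys xM yss yx.
have /andP[l0 l1] := l01.
(* L collects the families found so far. Vectors still to be split carry the factor 2 because the
   sum over a norming family is about twice the norm. *)
suff H : forall ys' (L : seq (nat * seq (nat -> R))) x', c00_bound x' M ->
  {in ys', forall y, (card_supp M y <= s.+1)%N} ->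
  {in L, forall p, (size p.2 <= p.1.+1)%N /\
    {in p.2, forall z, (card_supp M z <= s)%N /\ forall k, (k < p.1)%N -> z k = 0}} ->
  (forall k, \sum_(y <- ys') `|y k| + \sum_(p <- L) \sum_(z <- p.2) `|z k| <= x' k) ->
  exists cs, [/\ path leq 0%N cs, (size cs <= 4 * (size L + size ys'))%N &
    2 * (l * c) * \sum_(y <- ys') nT y +
    c * (\sum_(p <- L) \sum_(z <- p.2) nT z) <= 2 * slice_sum nT x' 0 cs].
  have [//|k|cs [p1 s1 h1]] := H ys [::] x xM yss.
    by rewrite big_nil addr0.
  by exists cs; split=> //; move: h1; rewrite big_nil; lra.
elim=> [|y ys' IH] L x' xM' yss' HL Lx.
  have [|cs [p1 s1 h1]] := intervals_pieces c0 U xM' HL.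
    by move=> k; have := Lx k; rewrite big_nil add0r.
  by exists cs; rewrite addn0 big_nil mulr0 add0r.
have cx' : c00 x' by exists M.
have Lx0 k : 0 <= \sum_(y <- ys') `|y k| + \sum_(p <- L) \sum_(z <- p.2) `|z k|.
  apply: addr_ge0; first exact: sumr_ge0.
  by apply: sumr_ge0 => p _; apply: sumr_ge0.
have yx' k : `|y k| <= x' k.
  have := Lx k; rewrite big_cons; have := Lx0 k; lra.
have yM : c00_bound y M.
  by apply: c00_bound_le xM' => k; apply: le_trans (yx' k) (ler_norm _).
have cy : c00 y by exists M.
have yss1 : {in ys', forall y, (card_supp M y <= s.+1)%N}.
  by move=> z zz; apply: yss'; rewrite inE zz orbT.
case: (N_split_or_coord yM l01) => [[k yk]|[n [F [n0 aF pr yF]]]].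
  (* All of y is taken out of x', so that x2 dominates what remains; the coordinate k returns at the
     price of two intervals. *)
  pose x2 i := x' i - `|y i|.
  have x2M : c00_bound x2 M by move=> i Mi; rewrite /x2 xM' // yM // normr0 subr0.
  have [i|cs [p1 s1 h1]] := IH L x2 x2M yss1 HL.
    by have := Lx i; rewrite big_cons /x2; lra.
  have [|||cs' [p2 s2 h2]] := @slice_sum_insert x' x2 k `|y k| cx' _ _ _ cs 0%N p1 (leq0n k).
  - by move=> i; rewrite /x2 subr_ge0 yx' lerBlDr lerDl normr_ge0.
  - by [].
  - by rewrite /x2; lra.
  exists cs'; split=> //.
    by apply: leq_trans s2 _; rewrite /= -[(size ys').+1]addn1 addnA mulnDr; apply: leq_add.
  rewrite big_cons; have : c * (l * nT y) <= `|y k|.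
    by apply: le_trans yk; rewrite ler_piMl // mulr_ge0 // N_ge0.
  move=> h3; have := normr_ge0 (y k); lra.
(* An admissible family of n sets lives from coordinate n - 1 on. *)
have [||cs [p1 s1 h1]] := IH ((n.-1, [seq restr (F i) y | i <- enum 'I_n]) :: L) x' xM' yss1.
- move=> p; rewrite inE => /orP[/eqP->|/HL //] /=; split.
    by rewrite size_map size_enum_ord prednK.
  move=> _ /mapP[i _ ->]; split.
    by have := pr i; have := yss' y (mem_head _ _); lia.
  move=> k kn; rewrite /restr; case: ifP => // kF.
  by have [_ [h _]] := aF; have := h _ _ kF; lia.
- move=> k; apply: le_trans (Lx k); rewrite !big_cons addrCA addrA; apply: lerD => //.
  rewrite lerD2r big_map big_enum /=.
  apply: le_trans (@sum_at_most_one R n (fun i => k \in F i) `|y k| _ _) => //.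
    by apply: ler_sum => i _; rewrite /restr; case: ifP; rewrite ?normr0.
  by move=> i j; apply: adm_disj.
exists cs; split=> //; first by rewrite /= addnS; move: s1; rewrite /= addSn.
apply: le_trans h1; rewrite !big_cons big_map big_enum /=.
have := ler_wpM2l c0 yF; lra.
Qed.

Lemma intervals_bound_exp l s : 0 <= l < 1 -> intervals_bound (l ^+ s) s.
Proof.
move=> l01; have /andP[l0 l1] := l01; elim: s => [|s IH].
  move=> M x ys xM yss yx; exists [::]; split=> //=.
  rewrite big_seq big1 ?mulr0 // => y yy.
  rewrite (@card_supp0 _ M y) ?N0 //; first exact: (fam_bound xM yx yy).
  by have := yss y yy; lia.
rewrite exprS; apply: intervals_step => //.
by rewrite exprn_ge0 // exprn_ile1 // ltW.
Qed.

(** Supports have at most M elements, and l = 1 - 1 / (4 (M + 1)) satisfies l^M >= 3/4. Since x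
    vanishes below 4 n, the 4 n intervals are admissible with sum at most 2 [nT x]; and 2 / (3/4) <=
    3. *)
Lemma N_disjoint_lower n x (xs : 'I_n -> nat -> R) : c00 x ->
  (forall k, (k < 4 * n)%N -> x k = 0) ->
  (forall k, \sum_(j < n) `|xs j k| <= `|x k|) ->
  \sum_(j < n) nT (xs j) <= 3 * nT x.
Proof.
move=> [M xM] x0 xsx; have cx : c00 x by exists M.
pose xa k := `|x k|.
have xaM : c00_bound xa M by move=> i Mi; rewrite /xa xM // normr0.
have cxa : c00 xa by exists M.
have <- : nT xa = nT x by apply: N_abs => // k; rewrite /xa normr_id.
pose d : R := (4 * M.+1%:R)^-1.
have M0 : 0 < 4 * M.+1%:R :> R by rewrite mulr_gt0.
have d0 : 0 < d by rewrite invr_gt0.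
have dM : M.+1%:R * d = 4^-1 by rewrite /d invfM mulrCA divff ?mulr1 // pnatr_eq0.
have d1 : d <= 4^-1.
  by rewrite -dM ler_peMl ?(ltW d0) // ler1n.
have l01 : 0 <= 1 - d < 1 by apply/andP; split; lra.
have [||cs [pc sc H]] := @intervals_bound_exp (1 - d) M l01 M xa (map xs (enum 'I_n)) xaM.
- move=> y _; rewrite /card_supp; apply: (@leq_trans (\sum_(i < M) 1)%N).
    by apply: leq_sum => i _; case: eqP.
  by rewrite sum1_card card_ord.
- by move=> k; rewrite big_map big_enum.
rewrite big_map big_enum /= in H.
rewrite size_map size_enum_ord in sc.
have b := @bernoulli R (- d) M.
have {}b : 3 / 4 <= (1 - d) ^+ M.
  apply: le_trans (b _); last lra.
  have : M%:R * d <= M.+1%:R * d by rewrite ler_pM2r // ler_nat.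
  by rewrite dM mulrN; lra.
have S0 : 0 <= \sum_(j < n) nT (xs j).
  apply: sumr_ge0 => j _; apply: N_ge0; apply: c00_le cx => k.
  apply: le_trans (xsx k); rewrite (bigD1 j) //= lerDl.
  by apply: sumr_ge0.
have h1 := ler_wpM2r S0 b.
have h2 : slice_sum nT xa 0 cs <= 2 * nT xa.
  rewrite (@slice_sum_clip_low xa (4 * n)); last by move=> k kn; rewrite /xa x0 // normr0.
  apply: slice_sum_adm => //; first exact: path_maxn.
  by rewrite size_map; lia.
have := N_ge0 cxa; lra.
Qed.

(** * Bounds in the dual *)

Lemma dual_le_ge0 y (B : R) : dual_le nT y B -> 0 <= B.
Proof.
move=> yB.
have h1 := yB _ _ (@unit_seq_bound R 0); rewrite N_unit_seq mulr1 big_ord1 /unit_seq /= mulr1 in h1.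
have b2 : c00_bound (fun k => (-1) * unit_seq R 0 k) 1.
  by move=> i i1; rewrite (@unit_seq_bound R 0) // mulr0.
have := yB _ _ b2; rewrite NZ; last exact: unit_seq_c00.
by rewrite N_unit_seq normrN1 !mulr1 big_ord1 /unit_seq /= !mulr1; lra.
Qed.

(** Test y' against the absolute value of x with the signs of y'. *)
Lemma dual_le_mono y y' (B : R) : (forall k, `|y k| <= `|y' k|) -> dual_le nT y' B -> dual_le nT y B.
Proof.
move=> yy' y'B x M xM.
have B0 := dual_le_ge0 y'B; have cx : c00 x by exists M.
pose x' i := Num.sg (y' i) * `|x i|.
have x'x i : `|x' i| <= `|x i|.
  rewrite /x' normrM normr_id normr_sg; apply: ler_piMl => //.
  by case: eqP.
apply: (@le_trans _ _ (B * nT x')); last by apply: (ler_wpM2l B0); apply: N_mono.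
apply: le_trans (y'B x' M (c00_bound_le x'x xM)); apply: ler_sum => i _.
rewrite /x' mulrA (mulrC (y' i)) -normrEsg; apply: le_trans (ler_norm _) _.
by rewrite normrM; apply: ler_wpM2r.
Qed.

(** By duality: each coordinate is assigned to some [ys j] dominating g there. This splits the part
    of x beyond 4 n into n disjoint pieces, and [N_disjoint_lower] bounds the sum of their norms. *)
Lemma dual_le_max n (ys : 'I_n -> nat -> R) (B : R) g : 0 <= B ->
  (forall j, dual_le nT (ys j) B) ->
  (forall i, g i != 0 -> (4 * n <= i)%N /\ exists j, `|g i| <= `|ys j i|) ->
  dual_le nT g (3 * B).
Proof.
move=> B0 ysB gy x M xM; have cx : c00 x by exists M.
have Nx0 := N_ge0 cx.
case: n => [|n] in ys ysB gy *.
  rewrite big1 => [|i _]; first by rewrite !mulr_ge0.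
  by case: (eqVneq (g i) 0) => [->|/gy[_ [[]]//]]; rewrite mul0r.
have g0 i : (i < 4 * n.+1)%N -> g i = 0.
  by apply: contraTeq => /gy[h _]; rewrite -leqNgt.
have /choice[c Hc] i : exists j, `|g i| <= `|ys j i|.
  by case: (eqVneq (g i) 0) => [->|/gy[]//]; exists ord0; rewrite normr0.
pose xs (j : 'I_n.+1) i := if (4 * n.+1 <= i)%N && (c i == j) then `|x i| else 0.
have xst k : \sum_(j < n.+1) `|xs j k| <= `|tail (4 * n.+1) x k|.
  rewrite (bigD1 (c k)) //= big1 ?addr0 => [|j jc]; last first.
    by rewrite /xs eq_sym (negbTE jc) andbF normr0.
  by rewrite /xs eqxx andbT /tail; case: ifP; rewrite ?normr_id ?normr0.
have ctx : c00 (tail (4 * n.+1) x) by apply: c00_le cx; exact: tail_le.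
have xs0 j i : 0 <= xs j i by rewrite /xs; case: ifP.
have xsM j : c00_bound (xs j) M.
  by move=> i Mi; rewrite /xs xM // normr0 if_same.
apply: (@le_trans _ _ (\sum_(i < M) \sum_(j < n.+1) `|ys j i| * xs j i)).
  apply: ler_sum => i _; case: (ltnP i (4 * n.+1)) => hi.
    by rewrite g0 // mul0r; apply: sumr_ge0 => j _; rewrite mulr_ge0.
  rewrite (bigD1 (c i)) //= {1}/xs hi eqxx /=.
  rewrite -[X in X <= _]addr0; apply: lerD; last by apply: sumr_ge0 => j _; rewrite mulr_ge0.
  by apply: le_trans (ler_norm _) _; rewrite normrM; apply: ler_wpM2r.
rewrite exchange_big /=.
apply: (@le_trans _ _ (\sum_(j < n.+1) B * nT (xs j))).
  apply: ler_sum => j _.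
  have : dual_le nT (fun i => `|ys j i|) B by apply: dual_le_mono (ysB j) => k; rewrite normr_id.
  exact.
rewrite -mulr_sumr.
have := N_disjoint_lower ctx _ xst.
have tx : nT (tail (4 * n.+1) x) <= nT x by apply: N_mono => // k; apply: tail_le.
move=> h; have {}h : \sum_(j < n.+1) nT (xs j) <= 3 * nT (tail (4 * n.+1) x).
  by apply: h => k kn; rewrite /tail leqNgt kn.
have := ler_wpM2l B0 (le_trans h (ler_wpM2l (ler0n R 3) tx)); lra.
Qed.

(** * The dual norm and the space X *)

Lemma dual_le_pairing y (B r : R) : dual_le nT y B -> dual_pairings nT y r -> r <= B.
Proof.
move=> yB [x [M [xM [x1 ->]]]]; apply: le_trans (yB x M xM) _.
by rewrite ler_piMr // (dual_le_ge0 yB).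
Qed.

Lemma dual_le_in y (B : R) : dual_le nT y B -> in_Tdual nT y.
Proof. by move=> yB; exists B => r /(dual_le_pairing yB). Qed.

Lemma dual_le_norm_le y (B : R) : dual_le nT y B -> dual_norm nT y <= B.
Proof.
move=> yB; apply: ge_sup; last by move=> r /(dual_le_pairing yB).
exists 0; exists (fun=> 0), 0%N; split=> //; split; first by rewrite N0.
by rewrite big_ord0.
Qed.

Lemma dual_le_norm y : in_Tdual nT y -> dual_le nT y (dual_norm nT y).
Proof.
move=> yT x M xM; have cx : c00 x by exists M.
have [e|ne] := eqVneq (nT x) 0.
  rewrite e mulr0 big1 // => i _.
  have := N_ge_coord i cx; rewrite e normr_le0 => /eqP ->.
  by rewrite mulr0.
have Np : 0 < nT x by rewrite lt_neqAle eq_sym ne N_ge0.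
rewrite -ler_pdivrMr //; apply: le_sup_of => //.
exists (fun i => (nT x)^-1 * x i), M; split; first by move=> i Mi; rewrite xM // mulr0.
split; first by rewrite NZ // ger0_norm ?mulVf // invr_ge0 ltW.
by rewrite mulr_suml; apply: eq_bigr => i _; rewrite -mulrA [x i * _]mulrC.
Qed.

Lemma dual_leW y (B B' : R) : B <= B' -> dual_le nT y B -> dual_le nT y B'.
Proof.
move=> BB yB x M xM; apply: le_trans (yB x M xM) _.
by apply: ler_wpM2r => //; apply: N_ge0; exists M.
Qed.

Lemma dual_leD y z (B C : R) : dual_le nT y B -> dual_le nT z C ->
  dual_le nT (fun k => y k + z k) (B + C).
Proof.
move=> yB zC x M xM; rewrite mulrDl; apply: le_trans (lerD (yB x M xM) (zC x M xM)).
by rewrite -big_split /=; under eq_bigr do rewrite mulrDl.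
Qed.

Lemma dual_leZ y (B c : R) : dual_le nT y B -> dual_le nT (fun k => c * y k) (`|c| * B).
Proof.
move=> yB; suff h : dual_le nT (fun k => `|c| * y k) (`|c| * B).
  by apply: dual_le_mono h => k; rewrite !normrM normr_id.
move=> x M xM; rewrite -mulrA; apply: le_trans (ler_wpM2l (normr_ge0 c) (yB x M xM)).
by rewrite mulr_sumr; under eq_bigr do rewrite -mulrA.
Qed.

Lemma dual_le0 : dual_le nT (fun=> 0) 0.
Proof. by move=> x M xM; rewrite mul0r big1 // => i _; rewrite mul0r. Qed.

Lemma dual_le_sum n (ys : 'I_n -> nat -> R) (B : 'I_n -> R) :
  (forall j, dual_le nT (ys j) (B j)) ->
  dual_le nT (fun k => \sum_(j < n) ys j k) (\sum_(j < n) B j).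
Proof.
elim: n ys B => [|n IH] ys B H.
  rewrite big_ord0 (_ : (fun k => _) = fun=> 0); first exact: dual_le0.
  by apply/funext => k; rewrite big_ord0.
rewrite big_ord_recr (_ : (fun k => _) =
  fun k => \sum_(j < n) ys (widen_ord (leqnSn n) j) k + ys ord_max k).
  by apply: dual_leD => //; apply: IH.
by apply/funext => k; rewrite big_ord_recr.
Qed.

Lemma dual_le_unit_seq k : dual_le nT (unit_seq R k) 1.
Proof.
move=> x M xM; have cx : c00 x by exists M.
rewrite mul1r; case: (ltnP k M) => kM.
  rewrite (bigD1 (Ordinal kM)) //= big1 => [|i ik].
    by rewrite /unit_seq eqxx mul1r addr0; apply: le_trans (ler_norm _) (N_ge_coord k cx).
  by rewrite /unit_seq (_ : (i == k :> nat) = false) ?mul0r //; apply: negbTE.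
rewrite big1 ?N_ge0 // => i _; rewrite /unit_seq; case: eqP => [e|]; last by rewrite mul0r.
by have := ltn_ord i; rewrite e ltnNge kM.
Qed.

Lemma pairing_unit_seq y k : \sum_(i < k.+1) y i * unit_seq R k i = y k.
Proof.
rewrite big_ord_recr /= /unit_seq eqxx mulr1 big1 ?add0r // => i _.
by rewrite (_ : (i == k :> nat) = false) ?mulr0 // ltn_eqF.
Qed.

Lemma dual_le_coord y (B : R) k : dual_le nT y B -> `|y k| <= B.
Proof.
move=> yB; have h1 : dual_le nT (fun k => `|y k|) B.
  by apply: dual_le_mono yB => i; rewrite normr_id.
by have := h1 _ _ (@unit_seq_bound R k); rewrite (pairing_unit_seq (fun i => `|y i|)) N_unit_seq mulr1.
Qed.

Lemma dual_norm_ge0 y : in_Tdual nT y -> 0 <= dual_norm nT y.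
Proof. by move=> /dual_le_norm/dual_le_ge0. Qed.

Lemma dual_norm_unit_seq k : dual_norm nT (unit_seq R k) = 1.
Proof.
apply/eqP; rewrite eq_le (dual_le_norm_le (dual_le_unit_seq k)) /=.
by have := dual_le_coord k (dual_le_norm (dual_le_in (dual_le_unit_seq k))); rewrite /unit_seq eqxx normr1.
Qed.

Lemma dual_norm_abs y z : in_Tdual nT y -> (forall k, `|z k| = `|y k|) ->
  dual_norm nT z = dual_norm nT y.
Proof.
move=> yT e; have h : dual_le nT z (dual_norm nT y).
  by apply: dual_le_mono (dual_le_norm yT) => k; rewrite e.
apply/eqP; rewrite eq_le (dual_le_norm_le h) /=; apply: dual_le_norm_le.
by apply: dual_le_mono (dual_le_norm (dual_le_in h)) => k; rewrite e.
Qed.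

Lemma dual_normZ y (c : R) : in_Tdual nT y ->
  dual_norm nT (fun k => c * y k) = `|c| * dual_norm nT y.
Proof.
move=> yT; have h := dual_leZ c (dual_le_norm yT).
apply/eqP; rewrite eq_le (dual_le_norm_le h) /=.
have [->|c0] := eqVneq c 0.
  by rewrite normr0 mul0r (dual_norm_ge0) //; have := dual_le_in (dual_leZ 0 (dual_le_norm yT)).
have := dual_leZ c^-1 (dual_le_norm (dual_le_in h)).
rewrite (_ : (fun k => _) = y); last first.
  by apply/funext => k; rewrite mulrA mulVf // mul1r.
move=> /dual_le_norm_le; rewrite normfV ler_pdivlMl ?normr_gt0 //.
Qed.

Lemma c00_in_Tdual y : c00 y -> in_Tdual nT y.
Proof.
move=> [M yM]; rewrite (_ : y = fun k => \sum_(i < M) y i * unit_seq R i k).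
  by apply: (dual_le_in (B := \sum_(i < M) `|y i| * 1)); apply: dual_le_sum => i; apply/dual_leZ/dual_le_unit_seq.
apply/funext => k; case: (ltnP k M) => kM; last first.
  rewrite yM // big1 // => i _; rewrite /unit_seq (_ : (k == i) = false) ?mulr0 //.
  by apply: gtn_eqF; apply: leq_trans kM.
rewrite (bigD1 (Ordinal kM)) //= /unit_seq eqxx mulr1 big1 ?addr0 // => i ik.
by rewrite (_ : (k == i :> nat) = false) ?mulr0 // eq_sym; apply: negbTE.
Qed.

(** The counterpart of [dual_le] for X. Any majorant b of the inner norms may serve as witness, so
    sums and restrictions need no exact norms. *)
Definition mixed_le (x : V R) (B : R) :=
  exists2 b, (forall k, dual_le nT (x k) (b k)) & dual_le nT b B.

Lemma mixed_le_in (x : V R) (B : R) : mixed_le x B -> (forall k, in_Tdual nT (x k)) /\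
  dual_le nT (fun k => dual_norm nT (x k)) B.
Proof.
move=> [b xb bB]; have xT k : in_Tdual nT (x k) := dual_le_in (xb k).
split=> //; apply: dual_le_mono bB => k.
by rewrite !ger0_norm ?dual_norm_ge0 ?(dual_le_ge0 (xb k)) // dual_le_norm_le.
Qed.

Lemma tail_shrinks y (e : R) : in_Tdual nT y -> 0 < e -> exists n, dual_le nT (tail n y) e.
Proof. by move=> /dual_le_norm yB e0; exact: dual_shrinking yB e0. Qed.

(** A bounded outer profile has a convergent series because tails in T-dual tend to 0; conversely, a
    norm limit of the truncations has the same coordinates as the profile. *)
Lemma TdTdE (x : V R) : TdTd nT x <->
  (forall k, in_Tdual nT (x k)) /\ in_Tdual nT (fun k => dual_norm nT (x k)).
Proof.
split=> [[xT [z [zT cz]]]|[xT aT]]; split=> //.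
  set a := fun k => dual_norm nT (x k); suff <- : z = a by [].
  apply/funext => i; apply/eqP; rewrite -subr_eq0 -normr_le0.
  apply/ler_addgt0Pr => e e0; rewrite add0r; have [n0 Hn] := cz e e0.
  set n := maxn n0 i.+1; have := Hn n (leq_maxl _ _).
  have tT : in_Tdual nT (fun i => z i - trunc n a i).
    apply: (dual_le_in (B := _ + _)); apply: dual_leD (dual_le_norm zT) _.
    apply: dual_le_norm; apply: c00_in_Tdual; exists n => k nk.
    by rewrite /trunc ltnNge nk oppr0.
  rewrite ger0_norm ?dual_norm_ge0 // => lt.
  have := dual_le_coord i (dual_le_norm tT); rewrite /trunc leq_maxr.
  by move=> h; apply: le_trans h (ltW lt).
exists (fun k => dual_norm nT (x k)); split=> // e e0.
have [n0 H] := tail_shrinks aT (divr_gt0 e0 (ltr0n R 2)); exists n0 => n nn.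
have h : dual_le nT (fun i => dual_norm nT (x i) - trunc n (fun k => dual_norm nT (x k)) i) (e / 2).
  apply: dual_le_mono H => k; rewrite /trunc /tail; case: ltnP => kn; first by rewrite subrr normr0.
  by rewrite subr0 (leq_trans nn kn).
rewrite ger0_norm; last by apply: dual_norm_ge0; exact: dual_le_in h.
by have := dual_le_norm_le h; lra.
Qed.

Lemma mixed_le_TdTd (x : V R) (B : R) : mixed_le x B -> TdTd nT x.
Proof. by move=> /mixed_le_in[xT aB]; apply/TdTdE; split=> //; exact: dual_le_in aB. Qed.

Lemma mixed_le_norm_le (x : V R) (B : R) : mixed_le x B -> TdTd_norm nT x <= B.
Proof. by move=> /mixed_le_in[_]; exact: dual_le_norm_le. Qed.

Lemma TdTd_mixed_le (x : V R) : TdTd nT x -> mixed_le x (TdTd_norm nT x).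
Proof.
move=> /TdTdE[xT aT]; exists (fun k => dual_norm nT (x k)); last exact: dual_le_norm.
by move=> k; apply: dual_le_norm.
Qed.

Lemma mixed_leD (x y : V R) (B C : R) : mixed_le x B -> mixed_le y C -> mixed_le (vadd x y) (B + C).
Proof.
move=> [b xb bB] [c yc cC]; exists (fun k => b k + c k); last exact: dual_leD.
by move=> k; apply: dual_leD.
Qed.

Lemma mixed_leZ (x : V R) (B c : R) : mixed_le x B -> mixed_le (vscale c x) (`|c| * B).
Proof.
move=> [b xb bB]; exists (fun k => `|c| * b k).
  by move=> k; apply: dual_leZ.
by have := dual_leZ `|c| bB; rewrite normr_id.
Qed.

Lemma mixed_le_mono (x y : V R) (B : R) : (forall k i, `|y k i| <= `|x k i|) -> mixed_le x B -> mixed_le y B.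
Proof.
by move=> yx [b xb bB]; exists b => // k; apply: dual_le_mono (xb k); exact: yx.
Qed.

Lemma mixed_leW (x : V R) (B B' : R) : B <= B' -> mixed_le x B -> mixed_le x B'.
Proof. by move=> BB [b xb bB]; exists b => //; apply: dual_leW bB. Qed.

Lemma mixed_le0 : mixed_le (@vzero R) 0.
Proof. by exists (fun=> 0) => *; exact: dual_le0. Qed.

Lemma mixed_le_coord (x : V R) (B : R) k i : mixed_le x B -> `|x k i| <= B.
Proof.
move=> [b xb bB]; apply: le_trans (dual_le_coord i (xb k)) _.
by apply: le_trans (ler_norm _) _; apply: dual_le_coord bB.
Qed.

Lemma mixed_le_lincomb m (c : 'I_m -> R) (v : 'I_m -> V R) (B : 'I_m -> R) :
  (forall j, mixed_le (v j) (B j)) -> mixed_le (lincomb c v) (\sum_(j < m) `|c j| * B j).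
Proof.
elim: m c v B => [|m IH] c v B H.
  rewrite big_ord0 (_ : lincomb c v = vzero _); first exact: mixed_le0.
  by apply/funext => k; apply/funext => i; rewrite /lincomb big_ord0.
rewrite big_ord_recr /= (_ : lincomb c v =
  vadd (lincomb (fun j => c (widen_ord (leqnSn m) j)) (fun j => v (widen_ord (leqnSn m) j)))
    (vscale (c ord_max) (v ord_max))).
  by apply: mixed_leD; [exact: IH | exact: mixed_leZ].
by apply/funext => k; apply/funext => i; rewrite /lincomb big_ord_recr.
Qed.

Lemma TdTd_add (x y : V R) : TdTd nT x -> TdTd nT y -> TdTd nT (vadd x y).
Proof. by move=> /TdTd_mixed_le hx /TdTd_mixed_le hy; apply: mixed_le_TdTd (mixed_leD hx hy). Qed.

Lemma TdTd_scale (c : R) (x : V R) : TdTd nT x -> TdTd nT (vscale c x).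
Proof. by move=> /TdTd_mixed_le hx; apply: mixed_le_TdTd (mixed_leZ c hx). Qed.

(** The elementary tensor of the k-th outer unit vector with w. *)
Definition vrow (k : nat) (w : nat -> R) : V R := fun l i => if l == k then w i else 0.

Lemma vrow_mixed_le k w (B : R) : dual_le nT w B -> mixed_le (vrow k w) B.
Proof.
move=> wB; have B0 := dual_le_ge0 wB; exists (fun l => B * unit_seq R k l).
  move=> l; rewrite /vrow /unit_seq; case: eqP => _; first by rewrite mulr1.
  by rewrite mulr0; exact: dual_le0.
by have := dual_leZ B (dual_le_unit_seq k); rewrite mulr1 ger0_norm.
Qed.

Lemma vrow_norm k w : in_Tdual nT w -> TdTd_norm nT (vrow k w) = dual_norm nT w.
Proof.
move=> wT; rewrite /TdTd_norm (_ : (fun l => _) = fun l => dual_norm nT w * unit_seq R k l).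
  rewrite dual_normZ ?dual_norm_unit_seq ?mulr1 ?ger0_norm ?dual_norm_ge0 //.
  exact: dual_le_in (dual_le_unit_seq k).
apply/funext => l; rewrite /vrow /unit_seq; case: eqP => _; first by rewrite mulr1.
rewrite mulr0; apply/eqP; rewrite eq_le (dual_le_norm_le dual_le0) /=.
by apply: dual_norm_ge0; exact: dual_le_in dual_le0.
Qed.

(** * Failure of the asymptotic-c_0 property *)

Lemma lincomb_in (S Y : set (V R)) m (c : 'I_m -> R) (v : 'I_m -> V R) :
  linear_subspace S Y -> (forall j, Y (v j)) -> Y (lincomb c v).
Proof.
move=> [_ [Y0 [YD YZ]]]; elim: m c v => [|m IH] c v H.
  rewrite (_ : lincomb c v = vzero _) //.
  by apply/funext => k; apply/funext => i; rewrite /lincomb big_ord0.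
rewrite (_ : lincomb c v =
  vadd (lincomb (fun j => c (widen_ord (leqnSn m) j)) (fun j => v (widen_ord (leqnSn m) j)))
    (vscale (c ord_max) (v ord_max))).
  by apply: YD; [exact: IH | exact: YZ].
by apply/funext => k; apply/funext => i; rewrite /lincomb big_ord_recr.
Qed.

(** Modulo Y, the m + 1 vectors are combinations of m vectors; a nonzero element of the left kernel
    of the coefficient matrix cancels these. *)
Lemma fincodim_dependence (S Y : set (V R)) (e : nat -> V R) :
  linear_subspace S Y -> finite_codim S Y -> (forall l, S (e l)) ->
  exists m (d : 'I_m -> R), Y (lincomb d (fun l => e l)) /\ exists l, d l != 0.
Proof.
move=> lY [m [v [Sv H]]] Se; exists m.+1.
have /choice[yc Hyc] (l : 'I_m.+1) : exists yc : V R * ('I_m -> R),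
    Y yc.1 /\ e l = vadd yc.1 (lincomb yc.2 v).
  by have [y [c [Yy E]]] := H _ (Se l); exists (y, c).
pose A := \matrix_(l < m.+1, j < m) (yc l).2 j.
have kA : kermx A != 0.
  rewrite kermx_eq0 /row_free neq_ltn; apply/orP; left.
  by rewrite ltnS rank_leq_col.
have /rowV0Pn[d /sub_kermxP dA d0] := kA.
exists (fun l => d 0 l); split; last first.
  have /existsP[l dl] : [exists l, d 0 l != 0].
    rewrite -[X in is_true X]negbK negb_exists; apply/negP => /forallP dl.
    by case/eqP: d0; apply/rowP => l; rewrite mxE; have := dl l; rewrite negbK => /eqP.
  by exists l.
rewrite (_ : lincomb _ _ = lincomb (fun l => d 0 l) (fun l => (yc l).1)).
  by apply: lincomb_in lY _ => l; case: (Hyc l).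
apply/funext => k; apply/funext => i; rewrite /lincomb.
under eq_bigr => l _ do rewrite (Hyc l).2 /vadd mulrDr.
rewrite big_split /= [X in _ + X](_ : _ = 0) ?addr0 // /lincomb.
under eq_bigr => l _ do rewrite mulr_sumr.
rewrite exchange_big /= big1 // => j _.
have := congr1 (fun B : 'rV_m => B 0 j) dA; rewrite !mxE => E.
under eq_bigr => l _ do rewrite mulrA.
rewrite -mulr_suml (_ : \sum_(l < m.+1) d 0 l * (yc l).2 j = 0) ?mul0r //.
by rewrite -[RHS]E; apply: eq_bigr => l _; rewrite mxE.
Qed.

(** The k-th row is an infinite dimensional copy of T-dual, so Y meets it in a nonzero vector. *)
Lemma fincodim_vrow (Y : set (V R)) k : closed_fincodim (TdTd nT) (TdTd_norm nT) Y ->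
  exists w, [/\ in_Tdual nT w, dual_norm nT w = 1 & Y (vrow k w)].
Proof.
move=> [lY [_ fY]].
have Se l : TdTd nT (vrow k (unit_seq R l)) by apply: mixed_le_TdTd (vrow_mixed_le k (dual_le_unit_seq l)).
have [m [d [Yd [l0 dl]]]] := fincodim_dependence lY fY Se.
pose w i := \sum_(l < m) d l * unit_seq R l i.
have wE (l : 'I_m) : w l = d l.
  rewrite /w (bigD1 l) //= /unit_seq eqxx mulr1 big1 ?addr0 // => j jl.
  by rewrite (_ : (l == j :> nat) = false) ?mulr0 // eq_sym; apply: negbTE.
have cw : c00 w by apply: c00_sum => l; apply/c00Z/unit_seq_c00.
have wT := c00_in_Tdual cw.
have w0 : 0 < dual_norm nT w.
  apply: lt_le_trans (dual_le_coord l0 (dual_le_norm wT)).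
  by rewrite wE normr_gt0.
have wT' := dual_leZ (dual_norm nT w)^-1 (dual_le_norm wT).
exists (fun i => (dual_norm nT w)^-1 * w i); split; first exact: dual_le_in wT'.
  by rewrite dual_normZ // ger0_norm ?mulVf ?gt_eqF // invr_ge0 ltW.
have [_ [_ [_ YZ]]] := lY; have := YZ (dual_norm nT w)^-1 _ Yd.
rewrite (_ : vscale _ _ = vrow k (fun i => (dual_norm nT w)^-1 * w i)) //.
apply/funext => j; apply/funext => i; rewrite /vscale /lincomb /vrow.
case: eqP => // _; rewrite big1 ?mulr0 // => l _; exact: mulr0.
Qed.

Definition ext N (a : 'I_N -> R) : nat -> R := fun k => oapp a 0 (insub k).

Lemma ext_ord N (a : 'I_N -> R) (j : 'I_N) : ext a j = a j.
Proof. by rewrite /ext valK. Qed.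

Lemma ext_out N (a : 'I_N -> R) k : (N <= k)%N -> ext a k = 0.
Proof. by move=> Nk; rewrite /ext insubN // -leqNgt. Qed.

Lemma ext_c00 N (a : 'I_N -> R) : c00 (ext a).
Proof. by exists N => k; apply: ext_out. Qed.

Lemma ext_in N (a : 'I_N -> R) : in_Tdual nT (ext a).
Proof. exact/c00_in_Tdual/ext_c00. Qed.

Definition initial_norm N (a : 'I_N -> R) : R := dual_norm nT (ext a).

Lemma initial_normE N (a : 'I_N -> R) y :
  (forall j : 'I_N, y j = a j) -> (forall k, (N <= k)%N -> y k = 0) ->
  initial_norm a = dual_norm nT y.
Proof.
move=> ya y0; congr dual_norm; apply/funext => k; case: (ltnP k N) => kN.
  by rewrite -[k]/(val (Ordinal kN)) ext_ord ya.
by rewrite ext_out // y0.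
Qed.

Lemma initial_norm_basis N : basis_norm (@initial_norm N).
Proof.
split; first by move=> a; apply/dual_norm_ge0/ext_in.
split.
  move=> a a0 i; have := dual_le_coord i (dual_le_norm (ext_in a)).
  by rewrite -/(initial_norm a) a0 ext_ord normr_le0 => /eqP.
split.
  move=> a k; rewrite /initial_norm -dual_normZ; last exact: ext_in.
  by apply: initial_normE => [j|i iN]; rewrite ?ext_ord // ext_out ?mulr0.
split.
  move=> a b; rewrite (@initial_normE _ _ (fun k => ext a k + ext b k)).
  - by apply/dual_le_norm_le/dual_leD; apply/dual_le_norm/ext_in.
  - by move=> j; rewrite !ext_ord.
  - by move=> k kN; rewrite !ext_out ?addr0.
split.
  move=> j; rewrite (@initial_normE _ _ (unit_seq R j)) ?dual_norm_unit_seq // => k.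
    by rewrite /unit_seq /unitv; case: eqP => [/val_inj ->|ne]; rewrite ?eqxx //; case: eqP => // e; case: ne; rewrite e.
  by move=> kN; rewrite /unit_seq gtn_eqF //; apply: leq_trans kN.
move=> a m n mn; apply: dual_le_norm_le; apply: dual_le_mono (dual_le_norm (ext_in (truncN n a))) => k.
case: (ltnP k N) => kN; last by rewrite !ext_out.
rewrite -[k]/(val (Ordinal kN)) !ext_ord /truncN /=.
by case: ltnP => km; rewrite ?normr0 // (leq_trans km mn).
Qed.

(** The j-th answer is a normalized vector in row j. Row k of a combination then has inner norm the
    absolute value of its k-th coefficient, so the two norms agree exactly. *)
Lemma initial_norm_game N (eps : R) : 0 < eps -> forall k (acc : seq (V R)),
  (size acc + k = N)%N ->
  (forall j, (j < size acc)%N -> exists w, [/\ in_Tdual nT w, dual_norm nT w = 1 &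
      nth (vzero R) acc j = vrow j w]) ->
  asym_game (TdTd nT) (TdTd_norm nT) k
    (fun s => C_equiv (1 + eps)
      (seq_norm (TdTd_norm nT) (fun i : 'I_N => nth (vzero R) s i)) (@initial_norm N)) acc.
Proof.
move=> e0; elim=> [|k IH] acc sz H /=; last first.
  move=> Y cY; have [w [wT w1 Yw]] := fincodim_vrow (size acc) cY.
  exists (vrow (size acc) w); split=> //; split; first by rewrite vrow_norm.
  apply: IH; first by rewrite size_rcons addSnnS.
  move=> j; rewrite size_rcons ltnS leq_eqVlt nth_rcons => /orP[/eqP->|jl].
    by rewrite ltnn eqxx; exists w.
  by rewrite jl; apply: H.
rewrite addn0 in sz.
have /choice[w Hw] (j : 'I_N) : exists w, [/\ in_Tdual nT w, dual_norm nT w = 1 &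
      nth (vzero R) acc j = vrow j w] by apply: H; rewrite sz.
suff E a : seq_norm (TdTd_norm nT) (fun i : 'I_N => nth (vzero R) acc i) a = initial_norm a.
  exists 1, 1; split=> //; split=> //; split; first by rewrite mulr1; lra.
  by move=> a; rewrite E divr1 mul1r.
rewrite /initial_norm -(dual_norm_abs (z := fun k => `|ext a k|) (ext_in a)); last first.
  by move=> k; rewrite normr_id.
congr dual_norm; apply/funext => k; rewrite /seq_norm /lincomb.
case: (ltnP k N) => kN; last first.
  rewrite ext_out // normr0 (_ : (fun i => _) = fun=> 0).
    apply/eqP; rewrite eq_le (dual_le_norm_le dual_le0) /=.
    by apply: dual_norm_ge0; exact: dual_le_in dual_le0.
  apply/funext => i; rewrite big1 // => j _; have [_ _ ->] := Hw j.
  by rewrite /vrow gtn_eqF ?mulr0 //; apply: leq_trans kN.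
pose j0 := Ordinal kN; have [wT w1 wE] := Hw j0.
rewrite (_ : (fun i => _) = fun i => a j0 * w j0 i).
  by rewrite dual_normZ // w1 mulr1 -[k]/(val j0) ext_ord.
apply/funext => i; rewrite (bigD1 j0) //= big1 ?addr0.
  by rewrite wE /vrow eqxx.
move=> j jj; have [_ _ ->] := Hw j; rewrite /vrow (_ : (k == j) = false) ?mulr0 //.
by rewrite eq_sym; apply: negbTE.
Qed.

Lemma initial_norm_asym N : in_asym_struct (TdTd nT) (TdTd_norm nT) (@initial_norm N).
Proof.
split; first exact: initial_norm_basis.
by move=> eps e0; apply: initial_norm_game.
Qed.

(** Otherwise the constant sequence 1 would be in T-dual, but its tails have coordinates 1 and
    cannot have norm at most 1/2. *)
Lemma initial_norm_unbounded (c : R) : exists N, c < @initial_norm N (fun=> 1).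
Proof.
apply: contrapT => H.
have cH N : @initial_norm N (fun=> 1) <= c.
  by rewrite leNgt; apply/negP => h; apply: H; exists N.
have f1 : dual_le nT (fun=> 1) c.
  move=> x M xM; have := dual_le_norm (ext_in (fun _ : 'I_M => 1)) xM.
  under eq_bigr do rewrite ext_ord.
  move=> h; apply: le_trans h _; apply: ler_wpM2r; last exact: cH.
  by apply: N_ge0; exists M.
have h2 : 0 < 2^-1 :> R by rewrite invr_gt0.
have [n hn] := dual_shrinking f1 h2.
have := dual_le_coord n hn; rewrite /tail leqnn normr1.
lra.
Qed.

Lemma linf_ge n (a : 'I_n -> R) j : `|a j| <= linf_norm a.
Proof. by rewrite /linf_norm; apply: (le_bigmax _ (fun j => `|a j|) j). Qed.

Lemma linf_le n (a : 'I_n -> R) (B : R) : 0 <= B -> (forall j, `|a j| <= B) -> linf_norm a <= B.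
Proof. by move=> B0 aB; apply: bigmax_le. Qed.

Lemma not_asymptotic_c0 : ~ asymptotic_c0 (TdTd nT) (TdTd_norm nT).
Proof.
move=> [c [c1 H]]; have [N cN] := initial_norm_unbounded c.
have [A [B [A0 [B0 [AB HAB]]]]] := H N _ (initial_norm_asym N).
case: N => [|N] in cN H HAB.
  have : initial_norm (fun _ : 'I_0 => 1) <= 0.
    rewrite (@initial_normE _ _ (fun=> 0)) => [|[]|] //.
    exact: dual_le_norm_le dual_le0.
  by lra.
(* Unit vectors have norm 1 on both sides. Hence A <= A * B <= c, while the vector of ones has norm
   at most A. *)
have B1 : 1 <= B.
  have [_ h] := HAB (unitv R ord0); have [_ [_ [_ [_ [h1 _]]]]] := initial_norm_basis N.+1.
  rewrite h1 mulr1 in h; apply: le_trans h.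
  by apply: le_trans (linf_ge _ ord0); rewrite /unitv eqxx normr1.
have [h _] := HAB (fun=> 1).
have : linf_norm (fun _ : 'I_N.+1 => 1 : R) <= 1 by apply: linf_le => // j; rewrite normr1.
move=> h'; have {}h := le_trans h h'; rewrite ler_pdivrMr // mul1r in h.
have : A <= A * B by rewrite ler_peMr // ltW.
lra.
Qed.

(** * Blocks produced by the game *)

Definition sqtail K (x : V R) : V R :=
  fun k i => if (k < K)%N && (i < K)%N then 0 else x k i.

Definition sqcut K (x : V R) : V R :=
  fun k i => if (k < K)%N && (i < K)%N then x k i else 0.

Definition sqzero K : set (V R) :=
  [set x | TdTd nT x /\ forall k i, (k < K)%N -> (i < K)%N -> x k i = 0].

(** Coordinates are norm continuous, which gives closedness; the K * K unit vectors of the square,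
    numbered by quotient and remainder modulo K, span a complement. *)
Lemma sqzero_closed_fincodim K :
  closed_fincodim (TdTd nT) (TdTd_norm nT) (sqzero K).
Proof.
split; first split.
- by move=> x [].
- split; first by split=> //; exact: mixed_le_TdTd mixed_le0.
  split=> [x y [xT x0] [yT y0]|c x [xT x0]]; split.
  + exact: TdTd_add.
  + by move=> k i kK iK; rewrite /vadd x0 // y0 // addr0.
  + exact: TdTd_scale.
  + by move=> k i kK iK; rewrite /vscale x0 // mulr0.
split.
  move=> y z Yy zT cv; split=> // k i kK iK.
  apply/eqP; rewrite -normr_le0; apply/ler_addgt0Pr => e e0; rewrite add0r.
  have [n0 Hn] := cv e e0; have := Hn n0 (leqnn _).
  have [yT y0] := Yy n0.
  have dT : TdTd nT (vsub (y n0) z).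
    rewrite (_ : vsub _ _ = vadd (y n0) (vscale (-1) z)).
      by apply: TdTd_add => //; apply: TdTd_scale.
    by apply/funext => l; apply/funext => j; rewrite /vsub /vadd /vscale mulN1r.
  have := mixed_le_coord k i (TdTd_mixed_le dT); rewrite /vsub y0 // sub0r normrN.
  by move=> h1 h2; apply: le_trans h1 (le_trans (ler_norm _) (ltW h2)).
exists (K * K)%N, (fun j => vrow (j %/ K)%N (unit_seq R (j %% K)%N)); split.
  by move=> j; apply: mixed_le_TdTd (vrow_mixed_le _ (dual_le_unit_seq _)).
move=> x xT; exists (sqtail K x), (fun j => x (j %/ K)%N (j %% K)%N); split.
  split; last by move=> k i kK iK; rewrite /sqtail kK iK.
  apply: mixed_le_TdTd (mixed_le_mono _ (TdTd_mixed_le xT)) => k i.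
  by rewrite /sqtail; case: ifP; rewrite ?normr0.
apply/funext => k; apply/funext => i; rewrite /vadd /lincomb /sqtail.
have K0 (j : 'I_(K * K)) : (0 < K)%N by case: K j => [|//] [].
case: ifP => [/andP[kK iK]|ki].
  have jl : (k * K + i < K * K)%N.
    by apply: (@leq_trans (k.+1 * K)); [rewrite mulSn addnC ltn_add2r | rewrite leq_mul2r kK orbT].
  have Kp : (0 < K)%N by apply: leq_trans kK.
  have e1 : ((k * K + i) %/ K = k)%N by rewrite divnMDl // divn_small // addn0.
  have e2 : ((k * K + i) %% K = i)%N by rewrite modnMDl modn_small.
  rewrite (bigD1 (Ordinal jl)) //= e1 e2 /vrow eqxx /unit_seq eqxx mulr1 big1 ?addr0 ?add0r // => j jj.
  case: (eqVneq k (j %/ K)%N) => [ek|]; last by rewrite mulr0.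
  case: (eqVneq i (j %% K)%N) => [ei|]; last by rewrite mulr0.
  case/eqP: jj; apply: val_inj => /=; by rewrite ek ei -divn_eq.
rewrite big1 ?addr0 // => j _; have Kp := K0 j.
rewrite /vrow; case: (eqVneq k (j %/ K)%N) => [ek|]; last by rewrite mulr0.
rewrite /unit_seq; case: (eqVneq i (j %% K)%N) => [ei|]; last by rewrite mulr0.
by move: ki; rewrite ek ei ltn_mod Kp ltn_divLR // ltn_ord.
Qed.

(** The rows from n1 on contribute at most e / 2; in each of the first n1 rows, an inner tail of
    norm at most e / (2 (n1 + 1)) is left. *)
Lemma sqtail_small (x : V R) (e : R) : TdTd nT x -> 0 < e ->
  exists K, mixed_le (sqtail K x) e.
Proof.
move=> /TdTdE[xT aT] e0; set a := fun k => dual_norm nT (x k) in aT.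
have [n1 h1] := tail_shrinks aT (divr_gt0 e0 (ltr0n R 2)).
pose d : R := e / 2 / n1.+1%:R.
have n0 : 0 < n1.+1%:R :> R by rewrite ltr0n.
have d0 : 0 < d by rewrite !divr_gt0.
have /choice[g Hg] k : exists n, dual_le nT (tail n (x k)) d by apply: tail_shrinks.
exists (maxn n1 (\max_(k < n1) g k)); set K := maxn _ _.
exists (fun k => \sum_(l < n1) d * unit_seq R l k + tail n1 a k); last first.
  apply: (@dual_leW _ (\sum_(l < n1) `|d| * 1 + e / 2)); last first.
    by apply: dual_leD h1; apply: dual_le_sum => l; apply/dual_leZ/dual_le_unit_seq.
  rewrite sumr_const card_ord mulr1 (ger0_norm (ltW d0)) -mulr_natr.
  suff : d * n1%:R <= e / 2 by lra.
  rewrite /d -mulrA; apply: ler_piMr; first by rewrite divr_ge0 // ltW.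
  by rewrite mulrC ler_pdivrMr // mul1r ler_nat.
move=> k; case: (ltnP k n1) => kn.
  rewrite (bigD1 (Ordinal kn)) //= big1 => [|l lk]; last first.
    by rewrite /unit_seq (_ : (k == l :> nat) = false) ?mulr0 // eq_sym; apply: negbTE.
  rewrite /unit_seq eqxx mulr1 addr0 /tail leqNgt kn addr0.
  apply: dual_le_mono (Hg k) => i; rewrite /sqtail /tail.
  case: ifP => [_|/negbT]; first by rewrite normr0.
  rewrite (leq_trans kn (leq_maxl _ _)) /= -leqNgt => Ki.
  rewrite ifT //; apply: leq_trans Ki; apply: leq_trans (leq_maxr _ _).
  exact: (@leq_bigmax_cond _ xpredT (fun k : 'I_n1 => g k) (Ordinal kn)).
rewrite big1 => [|l _]; last first.
  by rewrite /unit_seq gtn_eqF ?mulr0 //; apply: leq_trans kn.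
rewrite add0r /tail kn; apply: dual_le_mono (dual_le_norm (xT k)) => i.
by rewrite /sqtail; case: ifP; rewrite ?normr0.
Qed.

(** Choosing each subspace by a strategy that preserves I turns the game into one concrete play. *)
Lemma asym_game_inv (S : set (V R)) nv P (I : seq (V R) -> Prop) :
  (forall acc, I acc -> exists Y, closed_fincodim S nv Y /\
     forall x : V R, Y x -> nv x = 1 -> I (rcons acc x)) ->
  forall k acc, I acc -> asym_game S nv k P acc ->
  exists s, [/\ size s = (size acc + k)%N, I s & P s].
Proof.
move=> H; elim=> [|k IH] acc Ia /=; first by move=> Pa; exists acc; rewrite addn0.
have [Y [cY HY]] := H _ Ia => /(_ Y cY)[x [Yx [x1 g]]].
have [s [sz Is Ps]] := IH _ (HY x Yx x1) g.
by exists s; split=> //; rewrite sz size_rcons addSnnS.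
Qed.

(** The next subspace vanishes on a square chosen after the previous moves and large enough to carry
    all of them up to e. The constant 2 is 1 + eps for eps = 1. *)
Lemma game_blocks N (E : ('I_N -> R) -> R) (e : R) L : 0 < e ->
  in_asym_struct (TdTd nT) (TdTd_norm nT) E ->
  exists (x : 'I_N -> V R) (K : nat -> nat),
  [/\ forall j, TdTd nT (x j) /\ TdTd_norm nT (x j) = 1,
      forall (j : 'I_N) k i, (k < K j)%N -> (i < K j)%N -> x j k i = 0,
      forall j : 'I_N, mixed_le (sqtail (K j.+1) (x j)) e,
      (L <= K 0)%N /\ {homo K : i j / (i <= j)%N} &
      C_equiv 2 (seq_norm (TdTd_norm nT) x) E].
Proof.
move=> e0 [_ G].
have /choice[kap Hkap] (x : V R) : exists K, TdTd nT x -> mixed_le (sqtail K x) e.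
  case: (pselect (TdTd nT x)) => [xT|nx]; last by exists 0%N.
  by have [K HK] := sqtail_small xT e0; exists K.
pose Kof (acc : seq (V R)) := maxn L (\max_(x <- acc) kap x)%N.
pose I (acc : seq (V R)) := forall j, (j < size acc)%N ->
  sqzero (Kof (take j acc)) (nth (vzero R) acc j) /\
  TdTd_norm nT (nth (vzero R) acc j) = 1.
have HI acc : I acc -> exists Y, closed_fincodim (TdTd nT) (TdTd_norm nT) Y /\
     forall x : V R, Y x -> TdTd_norm nT x = 1 -> I (rcons acc x).
  move=> Ia; exists (sqzero (Kof acc)); split; first exact: sqzero_closed_fincodim.
  move=> x Yx x1 j; rewrite size_rcons ltnS leq_eqVlt nth_rcons => /orP[/eqP->|jl].
    by rewrite ltnn eqxx -cats1 take_size_cat.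
  by rewrite jl -cats1 takel_cat ?(ltnW jl) //; apply: Ia.
have I0 : I [::] by [].
have [s [sz Is Ps]] := asym_game_inv HI I0 (G 1 ltr01).
rewrite add0n in sz.
exists (fun j : 'I_N => nth (vzero R) s j), (fun j => Kof (take j s)).
have js (j : 'I_N) : (j < size s)%N by rewrite sz.
split.
- by move=> j; have [[h _] h'] := Is j (js j).
- by move=> j k i; have [[_ h] _] := Is j (js j); exact: h.
- move=> j; have [[h _] _] := Is j (js j).
  apply: mixed_le_mono (Hkap _ h) => k i; rewrite /sqtail.
  have le : (kap (nth (vzero R) s j) <= Kof (take j.+1 s))%N.
    rewrite (take_nth (vzero R) (js j)) /Kof -cats1 big_cat big_seq1.
    by rewrite (leq_trans _ (leq_maxr _ _)) // leq_maxr.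
  case: ifP => [_|H]; first by rewrite normr0.
  rewrite ifF //; apply/negP => /andP[a b]; move: H.
  by rewrite (leq_trans a le) (leq_trans b le).
- split; first by rewrite /Kof leq_maxl.
  move=> i j ij; rewrite /Kof geq_max leq_maxl /=.
  rewrite -(cat_take_drop i (take j s)) big_cat take_takel //.
  by rewrite (leq_trans _ (leq_maxr _ _)) // leq_maxl.
by have := Ps; rewrite (_ : 1 + 1 = 2 :> R) //; lra.
Qed.

(** A coordinate is the difference of two consecutive truncations, and the basis is monotone. *)
Lemma basis_coord N (E : ('I_N -> R) -> R) (b : 'I_N -> R) j : basis_norm E ->
  `|b j| <= 2 * E b.
Proof.
move=> [E0 [_ [EZ [ED [E1 EM]]]]].
have h m : (m <= N)%N -> E (truncN m b) <= E b.
  move=> mN; apply: le_trans (EM b m N mN) _.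
  rewrite (_ : truncN N b = b) //; apply/funext => i; by rewrite /truncN ltn_ord.
have -> : `|b j| = E (fun i => b j * unitv R j i) by rewrite EZ E1 mulr1.
rewrite (_ : (fun i => _) = fun i => truncN j.+1 b i + (-1) * truncN j b i).
  apply: le_trans (ED _ _) _; rewrite EZ normrN1 mul1r.
  have := h j.+1 (ltn_ord j); have := h j (ltnW (ltn_ord j)); lra.
apply/funext => i; rewrite /unitv /truncN; have [->|ij] := eqVneq i j.
  by rewrite ltnSn ltnn; lra.
rewrite ltnS leq_eqVlt (_ : (i == j :> nat) = false) /=; last exact: negbTE.
by case: ifP => _; lra.
Qed.

Lemma sum_unique n (F : 'I_n -> R) : (forall j j', F j != 0 -> F j' != 0 -> j = j') ->
  \sum_(j < n) F j != 0 -> exists2 j, F j != 0 & \sum_(j < n) F j = F j.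
Proof.
move=> H; case: (pickP (fun j => F j != 0)) => [j Fj|F0]; last first.
  by rewrite big1 ?eqxx // => j _; have := F0 j => /negbFE/eqP.
exists j => //; rewrite (bigD1 j) //= big1 ?addr0 // => j' jj.
by apply/eqP; apply: contraNT jj => h; rewrite (H _ _ h Fj).
Qed.

Lemma bigmax_attained n (F : 'I_n -> R) : \big[Num.max/0]_(j < n) F j != 0 ->
  exists j, \big[Num.max/0]_(j < n) F j = F j.
Proof.
apply: (big_rec (fun r => r != 0 -> exists j, r = F j)); first by rewrite eqxx.
move=> j r _ IH; rewrite maxEle; case: ifP => _ h; last by exists j.
exact: IH.
Qed.

(* The selected vectors agree up to e on the outer coordinates below 4 * n; beyond
   these, dual_le_max applies to the outer profiles. *)
Lemma outer_profile_bound n (al : 'I_n -> nat -> R) (e : R) :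
  (forall j, dual_le nT (al j) 1) -> (forall j k, 0 <= al j k) ->
  (forall i j k, (k < 4 * n)%N -> al i k <= al j k + e) -> 0 <= e ->
  (4 * n)%:R * e <= 1 ->
  dual_le nT (fun k => \big[Num.max/0]_(j < n) al j k) 5.
Proof.
move=> al1 al0 ale e0 ne; set m := fun k => _.
have m0 k : 0 <= m k by rewrite /m; apply: bigmax_ge_id.
have hi : dual_le nT (tail (4 * n) m) 3.
  rewrite -(mulr1 3); apply: (dual_le_max ler01 al1) => i.
  rewrite /tail; case: leqP => [h|]; last by rewrite eqxx.
  by move=> /bigmax_attained[j E]; split=> //; exists j; rewrite -E.
(* Below 4 n the maximum is at most the first profile plus e in each of the 4 n coordinates: norm at
   most 1 + 4 n e <= 2. *)
have lo : dual_le nT (fun k => if (k < 4 * n)%N then m k else 0) 2.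
  case: n al al1 al0 ale ne @m m0 {hi} => [|n] al al1 al0 ale ne m m0.
    by apply: dual_leW dual_le0.
  apply: (@dual_leW _ (1 + \sum_(l < 4 * n.+1) `|e| * 1)).
    rewrite sumr_const card_ord mulr1 ger0_norm // -mulr_natl; lra.
  apply: dual_le_mono (dual_leD (al1 ord0) (dual_le_sum (fun l => dual_leZ e (dual_le_unit_seq l)))) => k.
  have s0 : 0 <= \sum_(l < 4 * n.+1) e * unit_seq R l k.
    by apply: sumr_ge0 => l _; rewrite mulr_ge0 // ler0n.
  rewrite [X in _ <= X]ger0_norm ?addr_ge0 //.
  case: ifP => kn; last by rewrite normr0 addr_ge0.
  rewrite ger0_norm // (bigD1 (Ordinal kn)) //= /unit_seq eqxx mulr1.
  apply: (@le_trans _ _ (al ord0 k + e)); last first.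
    rewrite lerD2l lerDl; apply: sumr_ge0 => l _; by rewrite mulr_ge0 // ler0n.
  by apply: bigmax_le => [|j _]; [rewrite addr_ge0 | exact: ale].
apply: (@dual_leW _ (2 + 3)); first lra.
apply: dual_le_mono (dual_leD lo hi) => k; rewrite /tail.
by case: ltnP => _; rewrite ?addr0 ?add0r.
Qed.

(** For fixed outer coordinate k the supports are disjoint, since each vector lies in its larger
    square and outside its smaller one. Beyond 4 n, [dual_le_max] gives 3 B; below 4 n at most one
    vector is nonzero, which adds B. *)
Lemma inner_bound n (xs : 'I_n -> nat -> R) (K : nat -> nat) (t : 'I_n -> nat) k (B : R) :
  0 <= B -> (forall j, dual_le nT (xs j) B) ->
  (4 * n <= K 0)%N -> {homo K : i j / (i <= j)%N} ->
  (forall i j : 'I_n, t i = t j -> i = j) ->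
  (forall j i, xs j i != 0 -> [/\ (k < K (t j).+1)%N, (i < K (t j).+1)%N &
     (K (t j) <= k)%N || (K (t j) <= i)%N]) ->
  dual_le nT (fun i => \sum_(j < n) xs j i) (4 * B).
Proof.
move=> B0 xB K0 Kh tinj xsq.
have uniq i j j' : xs j i != 0 -> xs j' i != 0 -> j = j'.
  move=> /xsq[a1 b1 c1] /xsq[a2 b2 c2]; apply: tinj.
  case: (ltngtP (t j) (t j')) => // lt.
    have h := Kh _ _ lt.
    by exfalso; move: c2 a1 b1 h; clear; lia.
  have h := Kh _ _ lt.
  by exfalso; move: c1 a2 b2 h; clear; lia.
set g := fun i => _.
have hi : dual_le nT (tail (4 * n) g) (3 * B).
  apply: (dual_le_max B0 xB) => i; rewrite /tail; case: leqP => [h|]; last by rewrite eqxx.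
  by move=> /(sum_unique (uniq i))[j _ E]; split=> //; exists j; rewrite /g E.
have lo : dual_le nT (fun i => if (i < 4 * n)%N then g i else 0) B.
  case: (pselect (exists2 i, (i < 4 * n)%N & g i != 0)) => [[i0 in0 gi0]|H]; last first.
    apply: dual_leW B0 _; apply: dual_le_mono dual_le0 => i; case: ifP => h //.
    by rewrite (_ : g i = 0) //; apply/eqP; apply: contrapT => /negP gi; apply: H; exists i.
  have [j0 xj0 _] := sum_unique (uniq i0) gi0.
  (* As i < 4 n <= K 0, the vector avoids its smaller square only through k, and k lies between
     consecutive values of K for one index at most. *)
  have loc j i : (i < 4 * n)%N -> xs j i != 0 -> (K (t j) <= k < K (t j).+1)%N.
    move=> h /xsq[a _ /orP[->//|c]]; exfalso.
    by have := Kh 0%N (t j) (leq0n _); lia.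
  apply: dual_le_mono (xB j0) => i; case: ifP => h; last by rewrite normr0.
  have [->|gi] := eqVneq (g i) 0; first by rewrite normr0.
  have [j xj E] := sum_unique (uniq i) gi; rewrite /g E.
  have /andP[a1 a2] := loc _ _ in0 xj0; have /andP[b1 b2] := loc _ _ h xj.
  suff -> : j = j0 by [].
  apply: tinj; case: (ltngtP (t j) (t j0)) => // lt; have := Kh _ _ lt; lia.
apply: (@dual_leW _ (B + 3 * B)); first lra.
apply: dual_le_mono (dual_leD lo hi) => i; rewrite /tail.
by case: ltnP => _; rewrite ?addr0 ?add0r.
Qed.

(** * The asymptotic-subsequential-c_0 property *)

Lemma TdTd_infinite_dim : infinite_dim (TdTd nT).
Proof.
move=> m; exists (fun j => vrow 0 (unit_seq R j)); split.
  by move=> j; apply: mixed_le_TdTd (vrow_mixed_le _ (dual_le_unit_seq _)).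
move=> c c0 j; have := congr1 (fun v : V R => v 0%N j) c0.
rewrite /lincomb /vzero (bigD1 j) //= /vrow eqxx /unit_seq eqxx mulr1 big1 ?addr0 // => i ij.
by rewrite (_ : (j == i :> nat) = false) ?mulr0 // eq_sym; apply: negbTE.
Qed.

Lemma spread_lincomb n N (s : 'I_n -> 'I_N) (a : 'I_n -> R) (x : 'I_N -> V R) :
  lincomb (spread s a) x = lincomb a (fun j => x (s j)).
Proof.
apply/funext => k; apply/funext => i; rewrite /lincomb /spread.
under eq_bigr => l _ do rewrite mulr_suml.
rewrite (exchange_big_dep xpredT) //=; apply: eq_bigr => j _.
by rewrite (big_pred1 (s j)) // => l; rewrite /= eq_sym.
Qed.

Lemma spread_at n N (s : 'I_n -> 'I_N) (a : 'I_n -> R) j :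
  injective s -> spread s a (s j) = a j.
Proof.
by move=> sI; rewrite /spread (big_pred1 j) // => k; rewrite /= (inj_eq sI).
Qed.

(** On the squares, [inner_bound] bounds row k by 4 A m(k), and m has norm at most 5: this gives 20
    A. The n remainders add at most n A / (n + 1) <= A. *)
Lemma blocks_upper n N (x : 'I_N -> V R) (K : nat -> nat) (s : 'I_n -> 'I_N)
    (a : 'I_n -> R) :
  (forall j, TdTd nT (x j) /\ TdTd_norm nT (x j) = 1) ->
  (forall (j : 'I_N) k i, (k < K j)%N -> (i < K j)%N -> x j k i = 0) ->
  (forall j : 'I_N, mixed_le (sqtail (K j.+1) (x j)) n.+1%:R^-1) ->
  (4 * n <= K 0)%N -> {homo K : i j / (i <= j)%N} -> injective s ->
  (forall i j k, (k < 4 * n)%N -> dual_norm nT (x (s i) k) <=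
     dual_norm nT (x (s j) k) + (4 * n).+1%:R^-1) ->
  TdTd_norm nT (lincomb (spread s a) x) <= 21 * linf_norm a.
Proof.
move=> xT x0 xtail K0 Kh sI al; rewrite spread_lincomb; set A := linf_norm a.
have A0 : 0 <= A by apply: bigmax_ge_id.
have aA j : `|a j| <= A by apply: linf_ge.
have xTk j k : in_Tdual nT (x j k) by have [/TdTdE[h _] _] := xT j.
pose m k := \big[Num.max/0]_(j < n) dual_norm nT (x (s j) k).
have m0 k : 0 <= m k by apply: bigmax_ge_id.
have p0 : 0 < (4 * n).+1%:R :> R by rewrite ltr0n.
have q0 : 0 < n.+1%:R :> R by rewrite ltr0n.
have m5 : dual_le nT m 5.
  apply: (outer_profile_bound (e := (4 * n).+1%:R^-1)) => //.
  - move=> j; have [xjT x1] := xT (s j).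
    by have [_] := mixed_le_in (TdTd_mixed_le xjT); rewrite x1.
  - by move=> j k; apply: dual_norm_ge0.
  - by rewrite invr_ge0 ltW.
  by rewrite ler_pdivrMr // mul1r ler_nat.
pose mn : V R := fun k i => \sum_(j < n) a j * sqcut (K (s j).+1) (x (s j)) k i.
have hm : mixed_le mn (20 * A).
  exists (fun k => 4 * (A * m k)); last first.
    suff -> : (fun k => 4 * (A * m k)) = (fun k => (4 * A) * m k).
      have := dual_leZ (4 * A) m5; rewrite ger0_norm ?mulr_ge0 //.
      by apply: dual_leW; lra.
    by apply/funext => k; rewrite mulrA.
  move=> k; apply: (inner_bound (K := K) (t := fun j => s j)) => //.
  - by rewrite mulr_ge0.
  - move=> j; apply: (@dual_leW _ (`|a j| * dual_norm nT (x (s j) k))).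
      apply: ler_pM => //; first exact: dual_norm_ge0.
      exact: (le_bigmax _ (fun j => dual_norm nT (x (s j) k)) j).
    apply: dual_le_mono (dual_leZ (a j) (dual_le_norm (xTk (s j) k))) => i.
    rewrite /sqcut; case: ifP => // _; by rewrite mulr0 normr0.
  - by move=> i j /val_inj /sI.
  move=> j i; rewrite /sqcut; case: ifP => [/andP[kK iK]|]; last by rewrite mulr0 eqxx.
  move=> ne; split; [exact: kK | exact: iK | rewrite /=]; apply: contraNT ne; rewrite negb_or -!ltnNge => /andP[h1 h2].
  by rewrite x0 // mulr0.
have hr : mixed_le (lincomb a (fun j => sqtail (K (s j).+1) (x (s j)))) A.
  apply: mixed_leW (mixed_le_lincomb a (fun j => xtail (s j))).
  apply: (@le_trans _ _ (\sum_(j < n) A * n.+1%:R^-1)).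
    by apply: ler_sum => j _; apply: ler_wpM2r; rewrite ?invr_ge0 ?ler0n.
  rewrite sumr_const card_ord -[_ *+ n]mulr_natr -mulrA; apply: ler_piMr => //.
  by rewrite mulrC ler_pdivrMr // mul1r ler_nat.
rewrite (_ : lincomb a _ = vadd mn (lincomb a (fun j => sqtail (K (s j).+1) (x (s j))))).
  by apply: le_trans (mixed_le_norm_le (mixed_leD hm hr)) _; lra.
apply/funext => k; apply/funext => i; rewrite /vadd /mn /lincomb -big_split.
apply: eq_bigr => j _; rewrite /= -mulrDr /sqcut /sqtail.
by case: ifP; rewrite ?addr0 ?add0r.
Qed.

Lemma asymptotic_subsequential : asymptotic_subsequential_c0 (TdTd nT) (TdTd_norm nT).
Proof.
split; first exact: TdTd_infinite_dim.
exists 84; split; first lra.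
move=> n; pose L := (4 * n)%N; pose D : finType := {ffun 'I_L -> 'I_L.+2}.
exists (#|D| * n).+1 => E HE.
have [bE _] := HE; have p0 : 0 < L.+1%:R :> R by rewrite ltr0n.
have e0 : 0 < n.+1%:R^-1 :> R by rewrite invr_gt0 ltr0n.
have [x [K [xT x0 xtail [K0 Kh] [A1 [B1 [A1p [B1p [AB HAB]]]]]]]] := game_blocks L e0 HE.
pose al j k := dual_norm nT (x j k).
have xTk j k : in_Tdual nT (x j k) by have [/TdTdE[h _] _] := xT j.
have al0 j k : 0 <= al j k by apply: dual_norm_ge0.
have al1 j k : al j k <= 1.
  have [xjT x1] := xT j; have [_] := mixed_le_in (TdTd_mixed_le xjT); rewrite x1 => h.
  by have := dual_le_coord k h; rewrite (ger0_norm (al0 j k)).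
(* Outer profiles have values in [0, 1]. On the first L coordinates they are rounded down to
   multiples of 1 / (L + 1), which leaves L + 2 values; equal roundings differ by less than 1 / (L +
   1). *)
pose q j k := Num.truncn (al j k * L.+1%:R).
have qP j k : (q j k)%:R <= al j k * L.+1%:R < (q j k).+1%:R.
  by apply: truncn_itv; rewrite mulr_ge0 // ltW.
have qL j k : (q j k < L.+2)%N.
  rewrite ltnS -(ler_nat R); have /andP[h _] := qP j k; apply: le_trans h _.
  exact: ler_piMl.
pose c j : D := [ffun k : 'I_L => inord (q j k)].
have [d nd] := pigeonhole c (ltnSn (#|D| * n)).
have [s [smono sd]] := increasing_enum nd.
have sI : injective s.
  by move=> i j sij; case: (ltngtP i j) => [||/val_inj //]; rewrite -smono sij ltnn.
have cs i j : c (s i) = c (s j).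
  by have := sd i; have := sd j; rewrite !inE => /eqP-> /eqP->.
have close i j k : (k < 4 * n)%N -> al (s i) k <= al (s j) k + (4 * n).+1%:R^-1.
  move=> kL; have := congr1 (fun f : D => val (f (Ordinal kL))) (cs i j).
  rewrite /c !ffunE /= !inordK // => e.
  have /andP[h1 h2] := qP (s i) k; have /andP[h3 h4] := qP (s j) k.
  rewrite e -natr1 in h2; rewrite -(ler_pM2r p0) mulrDl mulVf ?gt_eqF //.
  by move: h2 h3; rewrite /al; lra.
(* Comparing a unit vector, of norm 1 on both sides, gives A1 >= 1 and hence B1 <= 2. *)
have A1_1 : 1 <= A1.
  have [h _] := HAB (unitv R ord0).
  have [_ [_ [_ [_ [hE _]]]]] := bE.
  rewrite hE /seq_norm (_ : lincomb _ _ = x ord0) in h.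
    by have [_ x1] := xT ord0; rewrite x1 div1r invf_le1 in h.
  apply/funext => k; apply/funext => i; rewrite /lincomb (bigD1 ord0) //=.
  rewrite /unitv eqxx mul1r big1 ?addr0 // => j jj.
  by rewrite (negbTE jj) mul0r.
have B2 : B1 <= 2 by apply: le_trans AB; rewrite ler_peMl // ltW.
(* The constant 42 is 2 * 21, from B1 and [blocks_upper]; 2 comes from [basis_coord]. *)
exists s; split=> //; exists 42, 2; split; first lra; split; first lra; split; first lra.
move=> a; split.
  have h := blocks_upper a xT x0 xtail K0 Kh sI close.
  have [_ hB] := HAB (spread s a); rewrite /seq_norm in hB.
  have l0 : 0 <= linf_norm a by apply: bigmax_ge_id.
  rewrite ler_pdivrMr; last lra.
  apply: le_trans hB _; apply: le_trans (ler_wpM2l (ltW B1p) h) _.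
  have : B1 * (21 * linf_norm a) <= 2 * (21 * linf_norm a).
    by apply: ler_wpM2r => //; rewrite mulr_ge0.
  lra.
have [E0 _] := bE.
apply: linf_le => [|j]; first by rewrite mulr_ge0.
by rewrite -(spread_at a j sI); apply: basis_coord.
Qed.

End Tsirelson.

Theorem theoremC (R : realType) (nT : (nat -> R) -> R) :
  is_tsirelson_norm nT ->
  asymptotic_subsequential_c0 (TdTd nT) (@TdTd_norm R nT) /\
  ~ asymptotic_c0 (TdTd nT) (@TdTd_norm R nT).
Proof.
by move=> hT; split; [exact: asymptotic_subsequential | exact: not_asymptotic_c0].
Qed.
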